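(* There exists a function $f:\mathbb{N}^3\to\mathbb{N}$ such that the following holds. Let $c$ be a positive integer, $p$ a prime, $k\ge 3$ an integer, and let $A$ be an elementary abelian group of order $p^{k}$ acting by automorphisms on a finite $p'$-group $G$. Suppose that, for some integer $d\ge 0$ with $2^{d}+2\le k$, the $d$th derived group $C_G(a)^{(d)}$ of $C_G(a)$ is nilpotent of class at most $c$ for every $a\in A^{\#}$. Then the $d$th derived group $G^{(d)}$ of $G$ is nilpotent, of nilpotency class at most $f(c,k,p)$.
   Context: A finite $p'$-group is a finite group whose order is not divisible by $p$. The action of $A$ on $G$ is by automorphisms and need not be faithful. $A^{\#}$ denotes the set of non-identity elements of $A$. For $a\in A$, $C_G(a)=\{x\in G : x^a=x\}$ is the subgroup of elements of $G$ fixed by $a$. For a group $H$, $H^{(i)}$ denotes the $i$th term of the derived series: $H^{(0)}=H$ and $H^{(i)}=[H^{(i-1)},H^{(i-1)}]$ for $i\ge 1$. In the source the bound is expressed by saying that the class is ''$\{c,k,p\}$-bounded'', meaning bounded above by some function depending only on $c$, $k$ and $p$. *)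

(* Defs.v *)
From mathcomp Require Import all_boot all_fingroup all_solvable.

Set Implicit Arguments.
Unset Strict Implicit.
Unset Printing Implicit Defensive.

Local Open Scope group_scope.

Definition nilpotent_class_le (gT : finGroupType) (H : {set gT}) (c : nat) : Prop :=
  nilpotent H /\ (nil_class H <= c)%N.

(* Main.v *)
From HB Require Import structures.
Require Import Defs.
From mathcomp Require Import all_boot all_fingroup all_solvable.
From mathcomp Require Import all_algebra all_field all_character.
From mathcomp Require Import zify.

(** The A-special subgroups of degree [d] generate [D = G^`(d)]. Each of them is centralised by
    a subgroup of index at most [p] in [A], and lies in [C_G(B)^`(d)] for some [B <= A] of index
    at most [p ^ (2 ^ d)]. As [2 ^ d + 2 <= k], for every special [H] and every [C <= A] of index
    at most [p] there is some [a != 1] in [C] with [H <= C_G(a)^`(d)]. Hence the Sylow subgroups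
    of special subgroups for different primes commute, and those for a given prime [s] lie in a
    single A-invariant Sylow [s]-subgroup of [G], so that [D] is nilpotent.

    For the class, if ['L_N.+1(D) != 1] let [q] be a prime divisor of ['L_N.+1(D) / 'L_N.+2(D)],
    and let the associated Lie ring of [D] act on its dual over a finite field [F] of
    characteristic [q] with primitive [p]-th roots of unity: [x] in ['L_j(D)] maps a homomorphism
    [phi] on ['L_(i+j)(D)] to [y |-> phi [~ y, x]]. The operators coming from special subgroups
    split into boundedly many A-eigenspaces, which are closed under brackets, graded modulo [p]
    by the eigenvalue of some [a] in [A], and nilpotent as sets of operators because
    [[C_G(a), H, ..., H] = 1]; the component of degree 0 comes from [C_D(a)], hence is solvable.
    A version of Kreknin's theorem with an ad-nilpotent component of degree 0 shows that their
    span is a solvable Lie ring. The associative ring it generates is then nilpotent of bounded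
    index, by collecting letters from the same eigenspace in long words. *)

Set Implicit Arguments.
Unset Strict Implicit.
Unset Printing Implicit Defensive.

Import GRing.Theory.

Local Open Scope group_scope.

(** * Nilpotency of graded families of ad-nilpotent subsets *)

Section GradedRings.

Local Open Scope ring_scope.

(** * Additive subgroups generated by a predicate *)

Section AdditiveSpan.

Variable V : zmodType.
Implicit Types (X P : V -> Prop).

Inductive zspan X : V -> Prop :=
| zspan0 : zspan X 0
| zspan1 x : X x -> zspan X x
| zspanB x y : zspan X x -> zspan X y -> zspan X (x - y).

Definition zclosed P := P 0 /\ forall x y, P x -> P y -> P (x - y).

Lemma zclosedN P x : zclosed P -> P x -> P (- x).
Proof. by case=> P0 PB Px; rewrite -sub0r; apply: PB. Qed.

Lemma zclosedD P x y : zclosed P -> P x -> P y -> P (x + y).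
Proof.
by move=> cP Px Py; rewrite -[y]opprK; apply: (proj2 cP) => //; apply: zclosedN.
Qed.

Lemma zclosed_sum P (I : Type) (r : seq I) (Q : pred I) F :
  zclosed P -> (forall i, Q i -> P (F i)) -> P (\sum_(i <- r | Q i) F i).
Proof.
move=> cP PF; elim/big_ind: _ => //; first by case: cP.
by move=> x y; apply: zclosedD.
Qed.

Lemma zspan_min X P :
  zclosed P -> (forall x, X x -> P x) -> forall x, zspan X x -> P x.
Proof.
move=> [P0 PB] XP x; elim=> // {}x y _ Px _ Py; exact: PB.
Qed.

Lemma zspan_closed X : zclosed (zspan X).
Proof. by split; [exact: zspan0 | exact: zspanB]. Qed.

Lemma zspan_sub X Y :
  (forall x, X x -> Y x) -> forall x, zspan X x -> zspan Y x.
Proof.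
by move=> XY; apply: zspan_min (zspan_closed Y) _ => x /XY; apply: zspan1.
Qed.

Lemma zspan_eq0 X : (forall x, X x -> x = 0) -> forall x, zspan X x -> x = 0.
Proof. by apply: zspan_min; split=> // x y -> ->; rewrite subrr. Qed.

End AdditiveSpan.

(** Reduces a claim additive in one variable to generators; bilinear claims apply it once per
    variable. *)
Lemma zspan_map (V W : zmodType) (f : V -> W) (X : V -> Prop) (P : W -> Prop) :
    (forall x y, f (x - y) = f x - f y) -> zclosed P ->
  (forall x, X x -> P (f x)) -> forall x, zspan X x -> P (f x).
Proof.
move=> fB [P0 PB] XP; apply: (@zspan_min _ X (fun x => P (f x))) => //.
split=> [|x y Px Py]; last by rewrite fB; apply: PB.
by rewrite -(subrr 0) fB subrr.
Qed.

Section RingSpan.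

Variable R : nzRingType.
Implicit Types (X P : R -> Prop).

Definition lie (x y : R) := x * y - y * x.

Lemma lieNC x y : lie x y = - lie y x.
Proof. by rewrite opprB. Qed.

Lemma lieBl x y z : lie (x - y) z = lie x z - lie y z.
Proof. by rewrite /lie mulrBl mulrBr !opprB addrACA addrA addrC !addrA [_ + x * z]addrC. Qed.

Lemma lieBr x y z : lie x (y - z) = lie x y - lie x z.
Proof. by rewrite lieNC lieBl opprB [lie y x]lieNC [lie z x]lieNC opprK addrC. Qed.

Lemma lie0r x : lie x 0 = 0.
Proof. by rewrite /lie mulr0 mul0r subrr. Qed.

Lemma lie0l x : lie 0 x = 0.
Proof. by rewrite /lie mulr0 mul0r subrr. Qed.

Lemma lie_jacobi x y z : lie x (lie y z) = lie (lie x y) z - lie (lie x z) y.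
Proof.
(* The six letters stand for the products of [x], [y], [z] in the six possible orders, so that
   Jacobi becomes a cancellation in an additive group. *)
have E (a b c d e f : R) :
  a - e - (f - d) = (a - b - (c - d)) - ((e - c) - (b - f)).
  rewrite !opprB [RHS](AC ((2*2)*(2*2)) ((1*8)*(3*6)*((2*5)*(4*7))))/=.
  by rewrite !addNr !addr0.
rewrite /lie !(mulrBl, mulrBr) !mulrA; exact: E.
Qed.

End RingSpan.

(** * Words, their reordering, and powers of an ideal *)

Section Words.

Variable R : nzRingType.
Implicit Types (X Y J : R -> Prop) (s t : seq R).

Definition word X s := forall x, x \in s -> X x.

Lemma word_cons X x s : word X (x :: s) <-> X x /\ word X s.
Proof.
split=> [Xs | [Xx Xs] y]; last by rewrite inE => /predU1P[-> | /Xs].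
by split=> [|y ys]; apply: Xs; rewrite inE ?eqxx ?ys ?orbT.
Qed.

Lemma word_cat X s t : word X (s ++ t) <-> word X s /\ word X t.
Proof.
split=> [Xst | [Xs Xt] x]; last by rewrite mem_cat => /orP[/Xs | /Xt].
by split=> x xs; apply: Xst; rewrite mem_cat xs ?orbT.
Qed.

Lemma sub_word X Y s : (forall x, X x -> Y x) -> word X s -> word Y s.
Proof. by move=> XY Xs x /Xs /XY. Qed.

(** Letters of [Y] commute modulo [J]: swapping two neighbours in a word costs a bracket times
    further letters, and [J] absorbs letters on both sides. *)
Lemma prod_perm_mod Y J s t :
    zclosed J -> (forall y r, Y y -> J r -> J (y * r)) ->
    (forall y r, Y y -> J r -> J (r * y)) ->
    (forall x y, Y x -> Y y -> J (lie x y)) ->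
    perm_eq s t -> word Y s ->
  J (\prod_(x <- s) x - \prod_(x <- t) x).
Proof.
move=> cJ JYl JYr JYY; have [J0 JB] := cJ.
have JM u r : word Y u -> J r -> J (r * \prod_(x <- u) x).
  elim: u r => [|x u IH] r; first by rewrite big_nil mulr1.
  by case/word_cons=> Yx Yu Jr; rewrite big_cons mulrA; apply: IH (JYr _ _ Yx Jr).
elim: s t => [|x s IHs] t.
  by rewrite perm_sym => /perm_nilP -> _; rewrite !big_nil subrr.
move=> xst /word_cons[Yx Ys].
have xt: x \in t by rewrite -(perm_mem xst) mem_head.
case/splitPr: t / xt xst => u v xst.
have suv: perm_eq s (u ++ v).
  by rewrite -(perm_cons x) (perm_trans xst) // -[x :: v]cat1s -[x :: _]cat1s perm_catCA.
have [Yu Yv]: word Y u /\ word Y v.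
  by apply/word_cat => y; rewrite -(perm_mem suv) => /Ys.
rewrite big_cons; set w := \prod_(_ <- s) _.
have -> : w = (w - \prod_(y <- u ++ v) y) + \prod_(y <- u ++ v) y by rewrite subrK.
rewrite mulrDr -addrA; apply: zclosedD => //; first by apply: JYl => //; apply: IHs.
(* Now [x] is moved past [u], one letter at a time. *)
elim: u Yu {xst suv} => [|y u IHu] /=; first by rewrite big_cons subrr.
case/word_cons=> Yy Yu; rewrite !big_cons.
set a := \prod_(_ <- u ++ v) _; set b := \prod_(_ <- _) _.
have -> : x * (y * a) - y * b = lie x y * a + y * (x * a - b).
  by rewrite /lie mulrBl mulrBr !mulrA subrKA.
apply: zclosedD => //; last by apply: JYl => //; apply: IHu.
by apply: JM; [apply/word_cat | apply: JYY].
Qed.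

(* For [X] stable under brackets with [Y], the [n]th power of the two-sided ideal generated by [X]
   in the ring generated by [Y]. *)
Fixpoint ideal_power X Y n : R -> Prop :=
  if n is n'.+1 then
    zspan (fun r => exists x r', [/\ X x, ideal_power X Y n' r' & r = x * r'])
  else zspan (fun r => exists2 s, word Y s & r = \prod_(x <- s) x).

Lemma ideal_power_closed X Y n : zclosed (ideal_power X Y n).
Proof. by case: n => [|n]; apply: zspan_closed. Qed.

Section Ideal.

Variables X Y : R -> Prop.
Hypothesis XY : forall x y, X x -> Y y -> X (lie y x).
Local Notation I := (ideal_power X Y).

(** Since [y * x = x * y + lie y x] and [lie y x] stays in [X], a letter of [Y] can be pushed to the
    right past the factors from [X]. *)
Lemma ideal_powerMl n y r : Y y -> I n r -> I n (y * r).
Proof.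
move=> Yy; elim: n r => [|n IH] r; apply: (zspan_map (f := *%R y)) => [u v||{}r].
- exact: mulrBr.
- exact: ideal_power_closed.
- case=> s Ys ->; apply: zspan1; exists (y :: s); last by rewrite big_cons.
  by apply/word_cons.
- exact: mulrBr.
- exact: ideal_power_closed.
case=> x [r' [Xx Ir' ->]].
have -> : y * (x * r') = x * (y * r') + lie y x * r'.
  by rewrite /lie mulrBl !mulrA addrC subrK.
apply: zclosedD; first exact: ideal_power_closed.
  by apply: zspan1; exists x, (y * r'); split=> //; apply: IH.
by apply: zspan1; exists (lie y x), r'; split=> //; apply: XY.
Qed.

Lemma ideal_powerMr n y r : Y y -> I n r -> I n (r * y).
Proof.
move=> Yy; elim: n r => [|n IH] r; apply: (zspan_map (f := *%R^~ y)) => [u v||{}r].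
- exact: mulrBl.
- exact: ideal_power_closed.
- case=> s Ys ->; apply: zspan1; exists (rcons s y).
    by rewrite -cats1; apply/word_cat; split=> //; apply/word_cons.
  by rewrite -cats1 big_cat big_seq1.
- exact: mulrBl.
- exact: ideal_power_closed.
case=> x [r' [Xx Ir' ->]]; rewrite -mulrA.
by apply: zspan1; exists x, (r' * y); split=> //; apply: IH.
Qed.

Lemma ideal_powerM n r r' : I 1 r -> I n r' -> I n.+1 (r * r').
Proof.
move=> Ir Ir'; move: r Ir.
apply: (zspan_map (f := *%R^~ r')) => [u v||r [x [u [Xx Iu ->]]]].
- exact: mulrBl.
- exact: ideal_power_closed.
rewrite -mulrA; apply: zspan1; exists x, (u * r'); split=> //.
move: u Iu; apply: (zspan_map (f := *%R^~ r')) => [u v||_ [s Ys ->]].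
- exact: mulrBl.
- exact: ideal_power_closed.
elim: s Ys => [|y s IH]; first by rewrite big_nil mul1r.
by case/word_cons=> Yy /IH; rewrite big_cons -mulrA; apply: ideal_powerMl.
Qed.

Lemma ideal_power_block b n s :
    (forall t, word Y t -> size t = b -> I 1 (\prod_(x <- t) x)) ->
  word Y s -> size s = (n * b)%N -> I n (\prod_(x <- s) x).
Proof.
move=> blockY; elim: n s => [|n IH] s Ys size_s; first by apply: zspan1; exists s.
move: Ys; rewrite -(cat_take_drop b s) big_cat => /word_cat[Yt Yd].
apply: ideal_powerM.
  by apply: blockY => //; apply: size_takel; rewrite size_s mulSn leq_addr.
by apply: IH => //; rewrite size_drop size_s mulSn addKn.
Qed.

Lemma ideal_power_eq0 n r :
    (forall t, word X t -> size t = n -> \prod_(x <- t) x = 0) ->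
  I n r -> r = 0.
Proof.
(* The prefix [t] records the factors from [X] already extracted; when none is left to extract,
   their product is 0. *)
move=> nilX Ir; suff gen m t u : I m u -> word X t -> (size t + m)%N = n ->
    \prod_(x <- t) x * u = 0.
  by have := gen n [::] r Ir; rewrite big_nil mul1r; apply.
elim: m t u => [|m IH] t {Ir}r Ir Xt size_t.
  by rewrite (nilX t) ?mul0r // -size_t addn0.
move: r Ir; apply: (zspan_map (f := *%R _) (P := fun z => z = 0)) => [u v||].
- exact: mulrBr.
- by split=> // u v -> ->; rewrite subrr.
move=> _ [x [r [Xx Ir ->]]].
have := IH (rcons t x) r Ir; rewrite -cats1 big_cat big_seq1 mulrA; apply.
  by apply/word_cat; split=> //; apply/word_cons.
by rewrite size_cat addnAC -addnA addn1.
Qed.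

End Ideal.

End Words.

(** * Solvable bracket-closed unions of nilpotent sets *)

Section ClosedFamilies.

Variable R : nzRingType.
Implicit Types (X Y : R -> Prop) (s t : seq R).

Fixpoint lie_der X n : R -> Prop :=
  if n is n'.+1 then
    fun x => exists y z, [/\ lie_der X n' y, lie_der X n' z & x = lie y z]
  else X.

Lemma lie_derSr X n x : lie_der X n.+1 x <-> lie_der (lie_der X 1) n x.
Proof.
elim: n x => // n IH x; split=> -[y [z [/IH Dy /IH Dz ->]]]; by exists y, z.
Qed.

Lemma pigeonhole_seq (I : finType) (t : seq I) c :
  (#|I| * c < size t)%N -> exists i, (c <= count_mem i t)%N.
Proof.
move=> lt_t; apply/existsP; apply: contraLR lt_t => /existsPn few; rewrite -leqNgt.
have -> : size t = (\sum_i count_mem i t)%N.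
  elim: t {few} => [|i t IH] /=; first by rewrite big1.
  by rewrite big_split /= -IH (bigD1 i) //= eqxx big1 // => j /negPf; rewrite eq_sym => ->.
rewrite -sum_nat_const; apply: leq_sum => i _.
by have := few i; rewrite -ltnNge => /ltnW.
Qed.

Variables (I : finType) (V : I -> R -> Prop) (m c : nat).
Hypothesis card_I : (#|I| <= m)%N.
Hypothesis nilV : forall i s, word (V i) s -> size s = c -> \prod_(x <- s) x = 0.

(** Pigeonhole: among more than [m * c] letters, [c] come from the same [V i]. Modulo [J] they can
    be brought to the front, where their product is 0. *)
Lemma long_word_mod Y J s :
    (forall x, Y x -> exists i, V i x) ->
    zclosed J -> (forall y r, Y y -> J r -> J (y * r)) ->
    (forall y r, Y y -> J r -> J (r * y)) ->
    (forall x y, Y x -> Y y -> J (lie x y)) ->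
  word Y s -> (m * c < size s)%N -> J (\prod_(x <- s) x).
Proof.
move=> YV cJ JYl JYr JYY Ys.
have [t Dt Vt]: exists2 t : seq (I * R), map snd t = s & {in t, forall u, V u.1 u.2}.
  elim: s Ys => [|x s IH]; first by exists [::].
  case/word_cons=> /YV[i Vix] /IH[t Dt Vt]; exists ((i, x) :: t); first by rewrite /= Dt.
  by move=> u; rewrite inE => /predU1P[-> | /Vt].
rewrite -Dt size_map -(size_map fst) => lt_s.
have [i] := pigeonhole_seq (leq_ltn_trans (leq_mul card_I (leqnn c)) lt_s).
rewrite count_map -size_filter; set ti := filter _ t => le_c_ti.
have: perm_eq s (map snd (ti ++ filter (predC [pred u : I * R | u.1 == i]) t)).
  by rewrite -Dt perm_map // perm_sym perm_filterC.
move/(prod_perm_mod cJ JYl JYr JYY)/(_ Ys); rewrite Dt map_cat big_cat /=.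
have nil_ti: \prod_(x <- take c (map snd ti)) x = 0.
  apply: (@nilV i); last by apply: size_takel; rewrite size_map.
  move=> x; rewrite -map_take => /mapP[u /mem_take].
  by rewrite mem_filter => /andP[/eqP <- /Vt Vu ->].
by rewrite -[map snd ti](cat_take_drop c) big_cat /= nil_ti !mul0r subr0.
Qed.

(** Induction on the derived length [e]. By [long_word_mod] a block of [(m * c).+1] letters lies in
    the ideal generated by the brackets [X1]; products of [(m * c).+1 ^ e] such brackets vanish by
    induction, so that many blocks suffice. *)
Lemma closed_family_nil e X s :
    (forall x, X x -> exists i, V i x) ->
    (forall x y, X x -> X y -> X (lie x y)) ->
    (forall x, lie_der X e x -> x = 0) ->
  word X s -> size s = ((m * c).+1 ^ e)%N -> \prod_(x <- s) x = 0.
Proof.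
elim: e X s => [|e IH] X s XV XX X0 Xs.
  case: s Xs => [|x [|y s]] // /word_cons[Xx _] _.
  by rewrite big_seq1; apply: X0.
rewrite expnSr => size_s; pose X1 := lie_der X 1.
have X1X x : X1 x -> X x by case=> y [z [Xy Xz ->]]; apply: XX.
have X1_lie x y : X1 x -> X y -> X1 (lie y x) by move=> /X1X Xx Xy; exists y, x.
have nilX1 t : word X1 t -> size t = ((m * c).+1 ^ e)%N -> \prod_(x <- t) x = 0.
  apply: (IH X1) => [x /X1X/XV //|x y X1x X1y|x /lie_derSr/X0 //].
  by apply: X1_lie => //; apply: X1X.
apply: (ideal_power_eq0 (X := X1) (Y := X)) nilX1 _.
apply: (ideal_power_block X1_lie _ Xs size_s) => t Xt size_t.
apply: (@long_word_mod X) => //.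
- exact: ideal_power_closed.
- by move=> y r; apply: ideal_powerMl.
- by move=> y r; apply: ideal_powerMr.
- move=> x y Xx Xy; apply: zspan1; exists (lie x y), 1; rewrite mulr1; split=> //.
    by exists x, y.
  by apply: zspan1; exists [::]; rewrite ?big_nil.
by rewrite size_t.
Qed.

End ClosedFamilies.

(** * Kreknin's induction for families graded modulo [n.+1] *)

Section GradedLie.

Variables (R : nzRingType) (n : nat).
Implicit Types (L M : 'I_n.+1 -> R -> Prop) (i j k : 'I_n.+1).

Definition graded L :=
  (forall i, zclosed (L i)) /\
  (forall i j x y, L i x -> L j y -> L (i + j) (lie x y)).

Definition graded_der L k : R -> Prop :=
  zspan (fun r => exists i j x y, [/\ i + j = k, L i x, L j y & r = lie x y]).

Lemma graded_der_sub L i x : graded L -> graded_der L i x -> L i x.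
Proof.
case=> cL mL; apply: zspan_min => // _ [a [b [y [z [<- Ly Lz ->]]]]].
exact: mL.
Qed.

Lemma graded_der_graded L : graded L -> graded (graded_der L).
Proof.
move=> gL; split=> [i | i j x y Dx Dy]; first exact: zspan_closed.
by apply: zspan1; exists i, j, x, y; split=> //; apply: graded_der_sub.
Qed.

Lemma graded_iter L s : graded L -> graded (iter s graded_der L).
Proof. by move=> gL; elim: s => //= s; apply: graded_der_graded. Qed.

Lemma graded_iter_sub L s i x : graded L -> iter s graded_der L i x -> L i x.
Proof.
move=> gL; elim: s => //= s IH Dx; apply: IH.
exact: graded_der_sub (graded_iter s gL) Dx.
Qed.

Fixpoint ad0 L r k : R -> Prop :=
  if r is r'.+1 then
    zspan (fun x => exists y z, [/\ ad0 L r' k y, L 0 z & x = lie y z])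
  else L k.

Lemma ad0_sub L M r k x :
  (forall i y, L i y -> M i y) -> ad0 L r k x -> ad0 M r k x.
Proof.
move=> LM; elim: r x => [|r IH] x /=; first exact: LM.
by apply: zspan_sub => _ [y [z [/IH My /LM Mz ->]]]; exists y, z.
Qed.

(** Degrees are compared through their representatives in [0..n]; for [a = n.+1] no [b] qualifies
    and only 0 remains, which ends Kreknin's induction. *)
Definition tail a L k : R -> Prop :=
  zspan (fun r => exists (b : 'I_n.+1) y z, [/\ (a <= b)%N, L (k - b) y, L b z & r = lie y z]).

(* In Kreknin's induction, sufficiently deep terms of the derived series consist of [good a]
   elements for larger and larger [a]; those that are good for [a > n] have zero brackets. *)
Definition good a L i (w : R) := forall j x, L j x -> tail a L (j + i) (lie x w).

Lemma good_closed a L i : zclosed (good a L i).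
Proof.
split=> [j x Lx | u v gu gv j x Lx]; first by rewrite lie0r; apply: zspan0.
by rewrite lieBr; apply: zspanB; [apply: gu | apply: gv].
Qed.

Lemma good_ge a L i w : (a <= i)%N -> L i w -> good a L i w.
Proof.
by move=> le_ai Lw j x Lx; apply: zspan1; exists i, x, w; rewrite addrK.
Qed.

(** By Jacobi, bracketing with [lie w v] amounts to bracketing with [w] and [v] in both orders, and
    in each order the last bracket is with a good element. *)
Lemma good_lie a L i j w v :
  graded L -> L i w -> L j v -> good a L i w -> good a L j v ->
  good a L (i + j) (lie w v).
Proof.
move=> [_ mL] Lw Lv gw gv l x Lx; rewrite lie_jacobi addrA; apply: zspanB.
  exact/gv/mL.
by rewrite addrAC; apply/gw/mL.
Qed.

Section Step.

Variables (t s : nat) (k : 'I_n.+1).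
Hypothesis k_neq0 : k != 0.
Hypothesis tail_k : forall L, graded L ->
    (forall i x, ad0 L t i x -> x = 0) ->
  forall i j w x, i != 0 -> iter s graded_der L i w -> iter s graded_der L j x ->
  tail k L (j + i) (lie x w).

Variable L : 'I_n.+1 -> R -> Prop.
Hypotheses (gL : graded L) (adL : forall i x, ad0 L t i x -> x = 0).

(** Brackets of two elements of degrees above [k] are good for [k.+1], by [good_ge] and [good_lie];
    the rest of degree [k] is to be pushed into long brackets with [L 0], which vanish. *)
Let above (r : R) := exists (i j : 'I_n.+1) x y,
  [/\ (k < i)%N, (k < j)%N, i + j = k, L i x & L j y /\ r = lie x y].
Let above_ad0 r := zspan (fun x => above x \/ ad0 L r k x).

(** The subtraction wraps around: [k - i] is represented by [k + n.+1 - i], and [i <= n]. *)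
Lemma lt_sub_ord i : (k < i)%N -> (k < (k - i)%R)%N.
Proof.
move=> lt_ki; have le_in := ltn_ord i; rewrite /= modnDmr.
by rewrite modn_small; lia.
Qed.

Lemma above_ad0_lie r x y : above_ad0 r x -> L 0 y -> above_ad0 r.+1 (lie x y).
Proof.
have [cL mL] := gL; move=> + Ly; move: x.
apply: (zspan_map (f := fun x => lie x y)) => [u v||x [[i [j [u [v]]]]|adx]].
- exact: lieBl.
- exact: zspan_closed.
- case=> lt_ki lt_kj Dk Lu [Lv ->]; rewrite lieNC lie_jacobi opprB.
  apply: zspanB; apply: zspan1; left.
    exists j, i, (lie y v), u; split=> //; first by rewrite addrC.
    by rewrite -(add0r j); apply: mL.
  exists i, j, (lie y u), v; split=> //.
  by rewrite -(add0r i); apply: mL.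
by apply: zspan1; right; apply: zspan1; exists x, y.
Qed.

(** Each round of [s.+1] derivations yields one more bracket with [L 0]. In a bracket of degree [k],
    if the right factor has degree 0 then the left one has degree [k] and induction applies to it;
    otherwise [tail_k] rewrites the bracket. *)
Lemma der_above_ad0 r x : iter (r * s.+1) graded_der L k x -> above_ad0 r x.
Proof.
elim: r x => [|r IH] x; first by move=> Lx; apply: zspan1; right.
rewrite mulSn iterD iterS; set M := iter _ _ L in IH *.
have gM: graded M by apply: graded_iter.
have ML i y : M i y -> L i y by apply: graded_iter_sub.
have MN i y : iter s graded_der M i y -> M i y by apply: graded_iter_sub.
apply: zspan_min => [|_ [i [j [y [z [Dk Ny Nz ->]]]]]]; first exact: zspan_closed.
have [j0 | j_neq0] := eqVneq j 0.
  by rewrite -Dk {}j0 addr0 in IH Nz *; apply: above_ad0_lie (ML _ _ (MN _ _ Nz)); apply/IH/MN.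
have adM l u : ad0 M t l u -> u = 0 by move/(ad0_sub ML)/adL.
have := tail_k gM adM j_neq0 Nz Ny; rewrite Dk.
apply: zspan_min => [|_ [b [u [v [le_kb Mu Mv ->]]]]]; first exact: zspan_closed.
(* If [b = k] the left factor has degree 0 and the bracket is flipped; if [b > k], then [k - b] is
   above [k] as well. *)
have [Dkb | lt_kb] := eqVneq b k.
  rewrite Dkb subrr in Mu Mv; rewrite lieNC; apply: zclosedN; first exact: zspan_closed.
  by apply: above_ad0_lie (ML _ _ Mu); apply: IH.
have {lt_kb}lt_kb: (k < b)%N by rewrite ltn_neqAle le_kb andbT eq_sym.
apply: zspan1; left; exists (k - b), b, u, v; rewrite subrK.
by split=> //; [apply: lt_sub_ord | apply: ML | split=> //; apply: ML].
Qed.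

(** After [t * s.+1] derivations degree [k] consists of elements good for [k.+1], because [ad0 L t]
    is zero. By [tail_k], [s] more derivations give [tail k], whose terms with [b = k] can then be
    replaced. *)
Lemma tail_step i j w x :
    i != 0 -> iter (t * s.+1 + s) graded_der L i w ->
    iter (t * s.+1 + s) graded_der L j x ->
  tail k.+1 L (j + i) (lie x w).
Proof.
rewrite addnC iterD; set M := iter _ _ L.
have gM: graded M by apply: graded_iter.
have ML l y : M l y -> L l y by apply: graded_iter_sub.
have adM l u : ad0 M t l u -> u = 0 by move/(ad0_sub ML)/adL.
have goodM y : M k y -> good k.+1 L k y.
  move/der_above_ad0; apply: zspan_min => [|z [[a [b [u [v]]]]|/adL->]].
  - exact: good_closed.
  - case=> lt_ka lt_kb Dk Lu [Lv ->]; rewrite -{2}Dk.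
    by apply: good_lie => //; apply: good_ge.
  by have [] := good_closed k.+1 L k.
move=> i_neq0 Nw Nx; move: (tail_k gM adM i_neq0 Nw Nx).
apply: zspan_min => [|_ [b [u [v [le_kb Mu Mv ->]]]]]; first exact: zspan_closed.
have [Dkb | lt_kb] := eqVneq b k.
  by rewrite -[_ + _](subrK k); apply: goodM; [rewrite -Dkb | apply: ML; rewrite -Dkb].
have {lt_kb}lt_kb: (k < b)%N by rewrite ltn_neqAle le_kb andbT eq_sym.
by apply: zspan1; exists b, u, v; split=> //; apply: ML.
Qed.

End Step.

End GradedLie.

(** The recursion of [tail_step], from [s] derivations at one level to [t * s.+1 + s] at the
    next. *)
Fixpoint kreknin (t k : nat) : nat :=
  if k is k'.+1 then (t * (kreknin t k').+1 + kreknin t k')%N else 0%N.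

Section Kreknin.

Variables (R : nzRingType) (n t : nat).

Lemma kreknin_tail k (L : 'I_n.+1 -> R -> Prop) i j w x :
    (k <= n)%N -> graded L -> (forall l y, ad0 L t l y -> y = 0) -> i != 0 ->
    iter (kreknin t k) (@graded_der R n) L i w ->
    iter (kreknin t k) (@graded_der R n) L j x ->
  tail k.+1 L (j + i) (lie x w).
Proof.
elim: k L i j w x => [|k IH] L i j w x le_kn gL adL i_neq0 /=.
  by move=> Lw Lx; apply: good_ge => //; rewrite lt0n.
have lt_kn: (k.+1 < n.+1)%N by [].
apply: (@tail_step R n t _ (Ordinal lt_kn)) => // M gM adM a b u v.
by apply: IH => //; apply: ltnW.
Qed.

(** Since [tail n.+1] is zero, brackets with a factor of nonzero degree vanish; one more derivation
    produces only such brackets in a nonzero degree. *)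
Lemma kreknin_der (L : 'I_n.+1 -> R -> Prop) i x :
    graded L -> (forall l y, ad0 L t l y -> y = 0) -> i != 0 ->
  iter (kreknin t n).+1 (@graded_der R n) L i x -> x = 0.
Proof.
move=> gL adL i_neq0; rewrite iterS; set M := iter _ _ L.
have bracket0 a b u v : b != 0 -> M a u -> M b v -> lie u v = 0.
  move=> b_neq0 Mu Mv.
  have := kreknin_tail (leqnn n) gL adL b_neq0 Mv Mu.
  apply: zspan_eq0 => r [l [y [z [lt_nl _ _ _]]]].
  by have := ltn_ord l; rewrite ltnNge lt_nl.
apply: zspan_eq0 => _ [a [b [u [v [Di Mu Mv ->]]]]].
have [b0 | b_neq0] := eqVneq b 0; last exact: bracket0 Mu Mv.
rewrite lieNC; apply/eqP; rewrite oppr_eq0; apply/eqP; apply: bracket0 Mv Mu.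
by rewrite -Di b0 addr0 in i_neq0.
Qed.

End Kreknin.

(** * Graded families of nilpotent sets with solvable degree 0 *)

Section GradedFamilies.

Variables (R : nzRingType) (n : nat) (I : finType) (V : I -> R -> Prop).
Variables (deg : I -> 'I_n.+1) (m c e : nat).
Hypothesis card_I : (#|I| <= m)%N.
Hypothesis nilV : forall i s, word (V i) s -> size s = c -> \prod_(x <- s) x = 0.
Hypothesis lieV : forall i j x y, V i x -> V j y ->
  exists2 k, deg k = deg i + deg j & V k (lie x y).

Let letter0 x := exists2 i, deg i = 0 & V i x.
Hypothesis sol0 : forall x, lie_der letter0 e x -> x = 0.

Let nil0 : nat := ((m * c).+1 ^ e)%N.
(** A bracket with [t] entries of degree 0 expands into products having at least [nil0] of them on
    one side, hence vanishes. *)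
Let t : nat := (nil0 + nil0)%N.

Let letter k x := exists2 i, deg i = k & V i x.
Let L k := zspan (letter k).

Let gL : graded L.
Proof.
split=> [i | i j x y Lx Ly]; first exact: zspan_closed.
move: x Lx; apply: (zspan_map (f := fun x => lie x y)) => [u v||x [a da Vx]].
- exact: lieBl.
- exact: zspan_closed.
move: y Ly; apply: (zspan_map (f := fun y => lie x y)) => [u v||y [b db Vy]].
- exact: lieBr.
- exact: zspan_closed.
have [k dk Vk] := lieV Vx Vy; apply: zspan1; exists k => //.
by rewrite dk da db.
Qed.

Let word0_nil s : word letter0 s -> (nil0 <= size s)%N -> \prod_(x <- s) x = 0.
Proof.
move=> Ls le_s; move: Ls; rewrite -(cat_take_drop nil0 s) => /word_cat[Lt _].
rewrite big_cat /= (@closed_family_nil _ I V m c card_I nilV e letter0) ?mul0r //.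
- by move=> x [i _]; exists i.
- move=> x y [i di Vx] [j dj Vy]; have [k dk Vk] := lieV Vx Vy.
  by exists k; rewrite // dk di dj addr0.
exact: size_takel.
Qed.

Let ad0_words r k x : ad0 L r k x ->
  zspan (fun z => exists u y v, [/\ word letter0 u, word letter0 v,
    (size u + size v)%N = r & z = \prod_(a <- u) a * y * \prod_(a <- v) a]) x.
Proof.
elim: r x => [|r IH] x /=.
  by move=> _; apply: zspan1; exists [::], x, [::]; rewrite !big_nil mul1r mulr1.
apply: zspan_min => [|_ [y [z [/IH + Lz ->]]]]; first exact: zspan_closed.
move: y; apply: (zspan_map (f := fun y => lie y z)) => [u v||].
- exact: lieBl.
- exact: zspan_closed.
move=> _ [u [y [v [Lu Lv suv ->]]]]; set w := _ * _.
move: z Lz; apply: (zspan_map (f := fun z => lie w z)) => [a b||z Lz].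
- exact: lieBr.
- exact: zspan_closed.
apply: zspanB; apply: zspan1.
  exists u, y, (rcons v z); rewrite -cats1 big_cat big_seq1 !mulrA size_cat -suv.
  by rewrite addn1 addnS; split=> //; apply/word_cat; split=> //; apply/word_cons.
exists (z :: u), y, v; rewrite big_cons !mulrA -suv.
by split=> //; apply/word_cons.
Qed.

Let adL k x : ad0 L t k x -> x = 0.
Proof.
move/ad0_words; apply: zspan_eq0 => _ [u [y [v [Lu Lv suv ->]]]].
have [le_u | lt_u] := leqP nil0 (size u); first by rewrite word0_nil // !mul0r.
rewrite (word0_nil Lv) ?mulr0 //; move: suv; rewrite /t; lia.
Qed.

Let s := (kreknin t n).+1.

Let lie_der_homogeneous j x :
  lie_der (fun x => exists i, V i x) j x -> exists2 k, iter j (@graded_der R n) L k x & letter k x.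
Proof.
elim: j x => [|j IH] x /=.
  by case=> i Vx; exists (deg i); [apply: zspan1; exists i | exists i].
case=> y [z [/IH[k Dy [a da Vy]] /IH[l Dz [b db Vz]] ->]].
exists (k + l); first by apply: zspan1; exists k, l, y, z.
by have [i di Vi] := lieV Vy Vz; exists i; rewrite // di da db.
Qed.

(** By Kreknin, only letters of degree 0 survive [s] derivations, and [sol0] kills these after [e]
    more. *)
Let lie_der_s j x :
  lie_der (fun x => exists i, V i x) (j + s) x -> x = 0 \/ lie_der letter0 j x.
Proof.
elim: j x => [|j IH] x.
  case/lie_der_homogeneous=> k Dx Lx; have [k0 | k_neq0] := eqVneq k 0.
    by right; rewrite k0 in Lx.
  by left; apply: kreknin_der Dx.
rewrite addSn => -[y [z [/IH[-> | Dy] /IH[-> | Dz] ->]]]; rewrite ?lie0l ?lie0r; try by left.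
by right; exists y, z.
Qed.

Definition family_bound (n m c e : nat) : nat :=
  let nil0 := ((m * c).+1 ^ e)%N in
  ((m * c).+1 ^ (e + (kreknin (nil0 + nil0) n).+1))%N.

Theorem graded_family_nil u :
    word (fun x => exists i, V i x) u -> size u = family_bound n m c e ->
  \prod_(x <- u) x = 0.
Proof.
apply: (closed_family_nil card_I nilV) => //.
- by move=> x y [i Vx] [j Vy]; have [k _ Vk] := lieV Vx Vy; exists k.
by move=> x /lie_der_s[] // /sol0.
Qed.

End GradedFamilies.

End GradedRings.

(** * Coprime action of an elementary abelian group *)

(* Subgroups of index at most [p], including [A] itself. *)
Definition hyperplane (gT : finGroupType) (p : nat) (A : {group gT}) : pred {group gT} :=
  fun B => (B \subset A) && (#|A| <= p * #|B|)%N.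

(** [A] acts irreducibly on [N], so the abelian group [A / 'C_A(N)], acting faithfully, is cyclic;
    being elementary abelian, it has order at most [p]. *)
Lemma minnormal_hyperplane (gT : finGroupType) (p : nat) (A N : {group gT}) :
    prime p -> p.-abelem A -> minnormal N A -> is_abelem N ->
  hyperplane p A 'C_A(N)%G.
Proof.
move=> p_pr abelA minN /is_abelemP[r r_pr abelN].
have /andP[ntN nNA] := mingroupp minN.
have := center_kquo_cyclic (elimT (abelem_mx_irrP abelN ntN nNA) minN).
rewrite rker_abelem (center_idP (quotient_abelian _ (abelem_abelian abelA))).
rewrite (abelem_cyclic (quotient_abelem _ abelA)).
have nCA: A \subset 'N('C_A(N)) by rewrite normsI ?normG ?norms_cent.
have pQ: p.-group (A / 'C_A(N)) := abelem_pgroup (quotient_abelem _ abelA).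
rewrite -(leq_exp2l _ _ (prime_gt1 p_pr)) -(card_pgroup pQ) expn1.
rewrite card_quotient // => le_p; rewrite /hyperplane subsetIl /= .
by rewrite -(Lagrange (subsetIl A 'C(N))) mulnC leq_mul2r le_p orbT.
Qed.

(** Induction along a minimal [A <*> X]-invariant subgroup [N] of [X]: the claim holds for [N] and
    for [X / N], and centralisers lift from [X / N] by coprimeness. *)
Lemma sol_coprime_gen_cent (gT : finGroupType) (p : nat) (A X : {group gT}) :
    prime p -> p.-abelem A -> A \subset 'N(X) -> coprime #|X| #|A| -> solvable X ->
  X \subset <<\bigcup_(B | hyperplane p A B) 'C_X(B)>>.
Proof.
move=> p_pr; have [n] := ubnP #|X|.
elim: n gT A X => // n IH gT A X /ltnSE le_Xn abelA nXA coXA solX.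
have [-> | ntX] := eqsVneq X 1; first exact: sub1G.
set K := <<_>>; pose AX := A <*> X.
have sXAX: X \subset AX by apply: joing_subr.
have nXAX: AX \subset 'N(X) by rewrite join_subG nXA normG.
have [|N minN sNX] := @mingroup_exists _ (fun N : {group gT} => (N :!=: 1) && (AX \subset 'N(N))) X.
  by rewrite ntX.
have [nNAX ntN abelN] := minnormal_solvable minN sNX solX.
have nNA: A \subset 'N(N) := subset_trans (joing_subl _ _) nNAX.
have nNX: X \subset 'N(N) := subset_trans sXAX nNAX.
have sCK (Y : {group gT}) : Y \subset X -> <<\bigcup_(B | hyperplane p A B) 'C_Y(B)>> \subset K.
  move=> sYX; rewrite gen_subG; apply/bigcupsP=> B hB.
  by apply: sub_gen; apply: (bigcup_max B); rewrite ?setSI.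
have [ltNX | nltNX] := boolP (N \proper X); last first.
  (* Here [X] is abelian and irreducible under [A <*> X], hence under [A], so ['C_A(X)] is a
     hyperplane centralising all of [X]. *)
  have defN: N :=: X by apply/eqP; rewrite properEneq sNX andbT negbK in nltNX.
  have minX: minnormal X A.
    apply/mingroupP; split=> [|M /andP[ntM nMA] sMX]; first by rewrite ntX.
    have [_ minN'] := mingroupP minN; rewrite -defN; apply: minN'; last by rewrite defN.
    rewrite ntM join_subG nMA /=; apply: subset_trans (cent_sub _).
    have [r _ /abelem_abelian] := is_abelemP abelN.
    by rewrite defN => /subset_trans-> //; apply: centS.
  apply: sub_gen.
  apply: (bigcup_max 'C_A(N)%G).
    by apply: minnormal_hyperplane => //; move: minX; rewrite -defN.
  by rewrite defN subsetI subxx centsC subsetIr.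
have sNK: N \subset K.
  apply: subset_trans (sCK _ sNX); apply: IH => //.
  - exact: leq_trans (proper_card ltNX) le_Xn.
  - exact: coprimeSg coXA.
  - exact: solvableS solX.
have coNA: coprime #|N| #|A| := coprimeSg sNX coXA.
have tiNA: N :&: A = 1 := coprime_TIg coNA.
have cardAN: #|A / N| = #|A| by rewrite -(card_isog (quotient_isog nNA tiNA)).
rewrite -(quotientSGK nNX) //; apply: subset_trans (IH _ (A / N)%G (X / N)%G _ _ _ _ _) _.
- rewrite card_quotient //; apply: leq_trans le_Xn; rewrite -(Lagrange sNX).
  by rewrite ltn_Pmull // cardG_gt1.
- exact: quotient_abelem.
- exact: quotient_norms.
- by rewrite coprime_morph.
- exact: quotient_sol.
rewrite gen_subG; apply/bigcupsP=> B' /andP[sB'A le_B'].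
(* As [A] embeds in the quotient by [N], lifting [B'] to [A] does not increase the index. *)
pose B := (A :&: coset N @*^-1 B')%G.
have defB': B / N = B'.
  by rewrite /quotient morphim_setIpre; apply/setIidPr.
have sBA: B \subset A by apply: subsetIl.
have nNB: B \subset 'N(N) := subset_trans sBA nNA.
have hB: hyperplane p A B.
  rewrite /hyperplane sBA -cardAN (leq_trans le_B') // -defB' leq_mul2l.
  by rewrite leq_morphim orbT.
rewrite -defB' -coprime_quotient_cent ?(coprimegS sBA) //.
by apply: quotientS; apply: sub_gen; apply: (bigcup_max B).
Qed.

(** For each prime [r] the solvable case covers an [A]-invariant Sylow [r]-subgroup of [X], so the
    order of the generated subgroup is divisible by the full [r]-part of [#|X|]. *)
Lemma coprime_gen_cent (gT : finGroupType) (p : nat) (A X : {group gT}) :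
    prime p -> p.-abelem A -> A \subset 'N(X) -> coprime #|X| #|A| ->
  X \subset <<\bigcup_(B | hyperplane p A B) 'C_X(B)>>.
Proof.
move=> p_pr abelA nXA coXA; set K := <<_>>.
have sKX: K \subset X.
  by rewrite gen_subG; apply/bigcupsP=> B _; apply: subsetIl.
suffices dvdXK: #|X| %| #|K|.
  have /eqP -> : K == X by rewrite eqEcard sKX dvdn_leq.
  exact: subxx.
apply/dvdn_partP=> // r _.
have solA := abelian_sol (abelem_abelian abelA).
have [P sylP nPA] := sol_coprime_Sylow_exists r solA nXA coXA.
rewrite -(card_Hall sylP); apply: cardSg; have sPX := pHall_sub sylP.
have /subset_trans -> // := sol_coprime_gen_cent p_pr abelA nPA (coprimeSg sPX coXA)
  (pgroup_sol (pHall_pgroup sylP)).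
by rewrite gen_subG; apply/bigcupsP=> B hB; apply: sub_gen; apply: (bigcup_max B); rewrite ?setSI.
Qed.

Lemma coprime_cent_prod (gT : finGroupType) (A G : {group gT}) :
    A \subset 'N(G) -> coprime #|G| #|A| -> solvable G ->
  G \subset [~: G, A] * 'C_G(A).
Proof.
move=> nGA coGA solG; have sRG: [~: G, A] \subset G by rewrite commg_subl.
have [nRG nRA]: G \subset 'N([~: G, A]) /\ A \subset 'N([~: G, A]).
  by apply/andP; rewrite -join_subG commg_norm.
rewrite -quotientSK // coprime_quotient_cent // subsetI subxx /=.
exact: quotient_cents2r.
Qed.

(** * A-special subgroups *)

Section Specials.

Variables (gT : finGroupType) (p : nat) (A G : {group gT}).
Hypotheses (p_pr : prime p) (abelA : p.-abelem A).
Hypotheses (nGA : A \subset 'N(G)) (coGA : coprime #|G| #|A|).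

Let hyperplanes : seq {group gT} := enum (hyperplane p A).

Definition commutator_cent (J K B : {group gT}) : {group gT} :=
  ([~: J, K] :&: 'C(B))%G.

Fixpoint Aspecial i : seq {group gT} :=
  if i is i'.+1 then
    [seq commutator_cent JK.1 JK.2 B |
      JK <- [seq (J, K) | J <- Aspecial i', K <- Aspecial i'], B <- hyperplanes]
  else [seq 'C_G(gval B)%G | B <- hyperplanes].

Lemma special0P H :
  reflect (exists2 B, hyperplane p A B & H = 'C_G(B)%G) (H \in Aspecial 0).
Proof.
apply: (iffP mapP) => -[B hB ->]; exists B => //; move: hB; by rewrite mem_enum.
Qed.

Lemma specialSP i H :
  reflect (exists J K B, [/\ J \in Aspecial i, K \in Aspecial i, hyperplane p A B
                           & H = ([~: J, K] :&: 'C(B))%G])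
          (H \in Aspecial i.+1).
Proof.
apply: (iffP allpairsP) => [[[[J K] B] /= [/allpairsP[[J' K'] /= [sJ sK [-> ->]]]]]|].
  by rewrite mem_enum => hB ->; exists J', K', B.
move=> [J [K [B [sJ sK hB ->]]]]; exists ((J, K), B); rewrite mem_enum; split=> //=.
by apply/allpairsP; exists (J, K).
Qed.

Fixpoint special_bound h i : nat :=
  if i is i'.+1 then (special_bound h i' ^ 2 * h)%N else h.

Lemma size_special i : (size (Aspecial i) <= special_bound (2 ^ #|A|) i)%N.
Proof.
have le_h: (size hyperplanes <= 2 ^ #|A|)%N.
  rewrite -cardE -card_powerset -(card_imset _ (@group_inj gT)) subset_leq_card //.
  by apply/subsetP=> _ /imsetP[B /andP[sBA _] ->]; rewrite inE.
elim: i => [|i IH]; first by rewrite size_map.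
by rewrite /= !size_allpairs; apply: leq_mul => //; apply: leq_mul.
Qed.

Lemma hyperplane_cent B : hyperplane p A B -> A \subset 'N('C(B)).
Proof.
case/andP=> sBA _; apply: norms_cent.
exact: sub_abelian_norm (abelem_abelian abelA) sBA.
Qed.

Lemma special_norm i H : H \in Aspecial i -> H \subset G /\ A \subset 'N(H).
Proof.
elim: i H => [|i IH] H.
  case/special0P=> B hB ->; split; first exact: subsetIl.
  by rewrite normsI // hyperplane_cent.
case/specialSP=> J [K [B [/IH[sJ nJ] /IH[sK nK] hB ->]]]; split.
  apply: subset_trans (subsetIl _ _) _; apply: subset_trans (commgSS sJ sK) _.
  by rewrite commg_subl normG.
by rewrite normsI ?hyperplane_cent ?normsR.
Qed.

Lemma special_cent i H : H \in Aspecial i -> exists2 B, hyperplane p A B & H \subset 'C(B).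
Proof.
case: i => [|i].
  by case/special0P=> B hB ->; exists B; rewrite ?subsetIr.
by case/specialSP=> J [K [B [_ _ hB ->]]]; exists B; rewrite ?subsetIr.
Qed.

Lemma leq_card_setI (a b : nat) (B C : {group gT}) :
    B \subset A -> C \subset A -> (#|A| <= a * #|B|)%N -> (#|A| <= b * #|C|)%N ->
  (#|A| <= a * b * #|B :&: C|)%N.
Proof.
move=> sBA sCA leB leC; rewrite -(leq_pmul2l (cardG_gt0 A)).
have le_BC: (#|B| * #|C| <= #|A| * #|B :&: C|)%N.
  by rewrite mul_cardG leq_mul2r subset_leq_card ?orbT // mul_subG.
apply: leq_trans (leq_mul leB leC) _; rewrite mulnACA [leqRHS]mulnCA leq_mul2l.
by rewrite le_BC orbT.
Qed.

(** The subgroups of [A] attached to [J] and [K] are intersected, which at worst multiplies the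
    indices and so doubles the exponent [2 ^ i]. *)
Lemma special_der i H : H \in Aspecial i ->
  exists B : {group gT},
    [/\ B \subset A, (#|A| <= p ^ (2 ^ i) * #|B|)%N & H \subset 'C_G(B)^`(i)].
Proof.
elim: i H => [|i IH] H.
  by case/special0P=> B /andP[sBA leB] ->; exists B.
case/specialSP=> J [K [C [/IH[B1 [sB1 le1 sJ]] /IH[B2 [sB2 le2 sK]] hC ->]]].
exists (B1 :&: B2)%G; split; first by rewrite subIset ?sB1.
  by rewrite expnS mul2n -addnn expnD leq_card_setI.
rewrite dergSn; apply: subset_trans (subsetIl _ _) _; apply: commgSS.
  by apply: subset_trans sJ _; rewrite dergS // setIS // centS // subsetIl.
by apply: subset_trans sK _; rewrite dergS // setIS // centS // subsetIr.
Qed.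

Lemma special_sub i H : H \in Aspecial i.+1 -> exists2 J, J \in Aspecial i & H \subset J.
Proof.
elim: i H => [|i IH] H.
  case/specialSP=> J [K [B [/special_norm[sJ _] /special_norm[sK _] hB ->]]].
  exists 'C_G(B)%G; first by apply/special0P; exists B.
  rewrite setSI //; apply: subset_trans (commgSS sJ sK) _.
  by rewrite commg_subl normG.
case/specialSP=> J [K [B [/IH[J' sJ' sJ] /IH[K' sK' sK] hB ->]]].
exists ([~: J', K'] :&: 'C(B))%G; first by apply/specialSP; exists J', K', B.
by rewrite setSI // commgSS.
Qed.

(** For positive [i], enlarge [H] and [K] to specials one level down; their commutator then gives a
    special of level [i]. This closes the family of eigenspaces under brackets. *)
Lemma special_comm i H K B :
    H \in Aspecial i -> K \in Aspecial i -> hyperplane p A B ->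
  exists2 J, J \in Aspecial i & [~: H, K] :&: 'C(B) \subset J.
Proof.
case: i => [|i] sH sK hB.
  exists 'C_G(B)%G; first by apply/special0P; exists B.
  rewrite setSI //; have [[sHG _] [sKG _]] := (special_norm sH, special_norm sK).
  by apply: subset_trans (commgSS sHG sKG) _; rewrite commg_subl normG.
have [[H' sH' sHH'] [K' sK' sKK']] := (special_sub sH, special_sub sK).
exists ([~: H', K'] :&: 'C(B))%G; first by apply/specialSP; exists H', K', B.
by rewrite setSI // commgSS.
Qed.

Lemma special_comm_sub i J K :
  J \in Aspecial i -> K \in Aspecial i ->
  [~: J, K] \subset <<\bigcup_(H <- Aspecial i.+1) H>>.
Proof.
move=> sJ sK; have [[sJG nJA] [sKG nKA]] := (special_norm sJ, special_norm sK).
have sJKG: [~: J, K] \subset G.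
  by apply: subset_trans (commgSS sJG sKG) _; rewrite commg_subl normG.
apply: subset_trans (coprime_gen_cent p_pr abelA (normsR nJA nKA) (coprimeSg sJKG coGA)) _.
rewrite gen_subG; apply/bigcupsP=> B hB; apply: sub_gen.
rewrite (big_rem ([~: J, K] :&: 'C(B))%G) ?subsetUl //.
by apply/specialSP; exists J, K, B.
Qed.

Lemma sub_gen_special i H : H \in Aspecial i -> H \subset <<\bigcup_(K <- Aspecial i) K>>.
Proof. by move=> sH; apply: sub_gen; rewrite (big_rem H) ?subsetUl. Qed.

Lemma gen_special_sub i (K : {group gT}) :
  (forall H, H \in Aspecial i -> H \subset K) -> <<\bigcup_(H <- Aspecial i) H>> \subset K.
Proof.
move=> sK; rewrite gen_subG; elim: (Aspecial i) sK => [|H s IH] sK.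
  by rewrite big_nil sub0set.
rewrite big_cons subUset sK ?mem_head //=; apply: IH => L Ls.
by rewrite sK // inE Ls orbT.
Qed.

(** Modulo the group [K] generated by level [i.+1], the specials of level [i] commute, and by
    induction the group they generate contains the [i]th derived group. *)
Lemma der_special i : G^`(i) \subset <<\bigcup_(H <- Aspecial i) H>>.
Proof.
elim: i => [|i IH].
  rewrite derg0; apply: subset_trans (coprime_gen_cent p_pr abelA nGA coGA) _.
  rewrite gen_subG; apply/bigcupsP=> B hB; apply: (sub_gen_special (H := 'C_G(B)%G)).
  by apply/special0P; exists B.
pose K := <<\bigcup_(H <- Aspecial i.+1) H>>%G; change (G^`(i.+1) \subset K).
have commK J J' : J \in Aspecial i -> J' \in Aspecial i -> [~: J, J'] \subset K.
  exact: special_comm_sub.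
(* A generator [h] of [K] lies in a special [J'] of level [i], so [h ^ x] is [h] times a commutator
   from [[~: J', J]], which [K] contains. *)
have nKJ J : J \in Aspecial i -> J \subset 'N(K).
  move=> sJ; apply/subsetP=> x Jx; rewrite inE sub_conjg.
  apply: (gen_special_sub (K := (K :^ x^-1)%G)) => H sH.
  rewrite -sub_conjg; apply/subsetP=> _ /imsetP[h Hh ->].
  have [J' sJ' sHJ'] := special_sub sH.
  rewrite -(mulKVg h (h ^ x)) -commgEl groupM //.
    by rewrite (subsetP (sub_gen_special sH)).
  by apply: (subsetP (commK _ _ sJ' sJ)); rewrite mem_commg // (subsetP sHJ').
set D := <<_>> in IH; have nKD: D \subset 'N(K) by apply: (gen_special_sub (K := 'N(K)%G)).
rewrite dergSn; apply: subset_trans (commgSS IH IH) _.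
rewrite -quotient_cents2 // sub_quotient_pre //.
apply: (gen_special_sub (K := (coset K @*^-1 'C(D / K))%G)) => J sJ.
rewrite -sub_quotient_pre ?nKJ // centsC sub_quotient_pre //.
apply: (gen_special_sub (K := (coset K @*^-1 'C(J / K))%G)) => J' sJ'.
by rewrite -sub_quotient_pre ?nKJ // quotient_cents2 ?nKJ // commK.
Qed.

End Specials.

(** * Nilpotency of the derived group *)

Section NilpotentDerived.

Variables (gT : finGroupType) (p k d : nat) (A G : {group gT}).
Hypotheses (p_pr : prime p) (abelA : p.-abelem A) (cardA : #|A| = (p ^ k)%N).
Hypotheses (nGA : A \subset 'N(G)) (coGA : coprime #|G| #|A|).
Hypothesis le_dk : (2 ^ d + 2 <= k)%N.
Hypothesis nilC : forall a, a \in A^# -> nilpotent 'C_G[a]^`(d).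

Notation spec := (Aspecial p A G d).

(** The two indices in [A] are at most [p ^ (2 ^ d)] and [p], so a trivial intersection would force
    [k <= 2 ^ d + 1]. *)
Lemma special_der_cent1 H C : H \in spec -> hyperplane p A C ->
  exists a, [/\ a \in A^#, a \in C & H \subset 'C_G[a]^`(d)].
Proof.
move=> sH /andP[sCA leC]; have [B [sBA leB sHB]] := special_der sH.
have /trivgPn[a /setIP[Ba Ca] nta]: B :&: C != 1.
  apply/eqP=> tiBC; have := leq_card_setI sBA sCA leB leC.
  rewrite tiBC cards1 muln1 cardA -expnSr leq_exp2l ?prime_gt1 //.
  by apply/negP; rewrite -ltnNge (leq_trans _ le_dk) // addn2.
exists a; rewrite !inE nta (subsetP sBA) //; split=> //.
have sC: 'C_G(B) \subset 'C_G[a] by rewrite -cent_set1 setIS ?centS ?sub1set.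
exact: subset_trans sHB (dergS d sC).
Qed.

Lemma special_nil H : H \in spec -> nilpotent H.
Proof.
move=> sH; have [C hC _] := special_cent sH.
have [a [Aa _ sHa]] := special_der_cent1 sH hC.
exact: nilpotentS sHa (nilC Aa).
Qed.

Lemma special_pcore (s : nat) (H : {group gT}) a : H \subset 'C_G[a]^`(d) -> a \in A^# ->
  'O_s(H) \subset 'O_s('C_G[a]^`(d)).
Proof.
move=> sHa Aa.
rewrite (sub_normal_Hall (nilpotent_pcore_Hall s (nilC Aa))) ?pcore_normal //.
  exact: pcore_pgroup.
exact: subset_trans (pcore_sub _ _) sHa.
Qed.

(** Some [A]-invariant Sylow subgroup [P] contains the core, and [P] and [S] are conjugate under
    ['C_G(A)]. The conjugating element centralises [a], so it normalises the core. *)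
Lemma pcore_sub_invariant_Sylow s (S : {group gT}) a :
    s.-Sylow(G) S -> A \subset 'N(S) -> a \in A^# ->
  'O_s('C_G[a]^`(d)) \subset S.
Proof.
move=> sylS nSA /setD1P[_ Aa]; set X := 'O_s(_).
have solA := abelian_sol (abelem_abelian abelA).
have nXC: 'C_G[a] \subset 'N(X) by do 2!apply: gFnorm_trans; apply: normG.
have nCA: A \subset 'N('C_G[a]).
  rewrite normsI // -cent_cycle norms_cent //.
  by rewrite (sub_abelian_norm (abelem_abelian abelA)) // cycle_subG.
have nXA: A \subset 'N(X) by do 2!apply: gFnorm_trans.
have sXG: X \subset G.
  by do 2!apply: gFsub_trans; apply: subsetIl.
have [P [sylP nPA sXP]] := sol_coprime_Sylow_subset nGA coGA solA sXG (pcore_pgroup _ _) nXA.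
have sylSA: S \in [set Q in 'Syl_s(G) | A \subset 'N(Q)] by rewrite !inE sylS.
have sylPA: P \in [set Q in 'Syl_s(G) | A \subset 'N(Q)] by rewrite !inE sylP.
have [g] := atransP2 (sol_coprime_Sylow_trans s solA nGA coGA) sylSA sylPA.
case/setIP=> Gg cAg /= defP; have Cg: g \in 'C_G[a].
  by rewrite inE Gg -cent_set1 (subsetP (centS _) _ cAg) // sub1set.
by rewrite -(conjSg _ _ g) (normsP nXC g Cg); move: sXP; rewrite defP.
Qed.

(* A commutator of [s]- and [r]-elements of [H] and [K] lies both in the [s]-core of some
   [C_G(a)^`(d)] containing [H], and in the [r]-core of some [C_G(b)^`(d)] containing [K]. *)
Lemma special_pcore_cents (s r : nat) (H K : {group gT}) : H \in spec -> K \in spec -> s != r ->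
  'O_s(H) \subset 'C('O_r(K)).
Proof.
move=> sH sK neq_sr.
have [[B hB cHB] [C hC cKC]] := (special_cent sH, special_cent sK).
have [[sHG _] [sKG _]] := (special_norm abelA nGA sH, special_norm abelA nGA sK).
have [a [Aa Ca sHa]] := special_der_cent1 sH hC.
have [b [Ab Bb sKb]] := special_der_cent1 sK hB.
have sub_cent1 (E : {group gT}) e : e \in E -> 'C(E) \subset 'C[e].
  by move=> Ee; rewrite -cent_set1 centS ?sub1set.
have nKa: 'O_r(K) \subset 'N('O_s('C_G[a]^`(d))).
  apply: subset_trans (pcore_sub _ _) _; do 2!apply: gFnorm_trans.
  by apply: subset_trans (normG _); rewrite subsetI sKG (subset_trans cKC) ?sub_cent1.
have nHb: 'O_s(H) \subset 'N('O_r('C_G[b]^`(d))).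
  apply: subset_trans (pcore_sub _ _) _; do 2!apply: gFnorm_trans.
  by apply: subset_trans (normG _); rewrite subsetI sHG (subset_trans cHB) ?sub_cent1.
apply/commG1P/trivgP.
have <-: 'O_s('C_G[a]^`(d)) :&: 'O_r('C_G[b]^`(d)) = 1.
  apply: coprime_TIg; apply: (pnat_coprime (pcore_pgroup s _)).
  by apply: pi_pnat (pcore_pgroup r _) _; rewrite !inE eq_sym.
rewrite subsetI; apply/andP; split.
  by apply: subset_trans (commSg _ (special_pcore s sHa Aa)) _; rewrite commg_subl.
by apply: subset_trans (commgS _ (special_pcore r sKb Ab)) _; rewrite commg_subr.
Qed.

Lemma nilpotent_der : nilpotent G^`(d).
Proof.
set D := (G^`(d))%G; pose Dp (s : nat) : {group gT} := <<\bigcup_(H <- spec) 'O_s(H)>>%G.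
have sDp (s : nat) (H : {group gT}) : H \in spec -> 'O_s(H) \subset Dp s.
  by move=> sH; apply: sub_gen; rewrite (big_rem H) ?subsetUl.
have Dp_min (s : nat) (K : {group gT}) :
    (forall H, H \in spec -> 'O_s(H) \subset K) -> Dp s \subset K.
  rewrite gen_subG; elim: spec => [|H t IH] sK; first by rewrite big_nil sub0set.
  rewrite big_cons subUset sK ?mem_head //=; apply: IH => L Lt.
  by rewrite sK // inE Lt orbT.
have sHD H : H \in spec -> H \subset D.
  move=> sH; have [B [_ _ sHB]] := special_der sH.
  by apply: subset_trans sHB (dergS _ _); apply: subsetIl.
(* All the cores ['O_s(H)] lie in one [A]-invariant Sylow [s]-subgroup of [G]. *)
have pDp (s : nat) : s.-group (Dp s).
  have solA := abelian_sol (abelem_abelian abelA).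
  have [S sylS nSA] := sol_coprime_Sylow_exists s solA nGA coGA.
  apply: pgroupS (pHall_pgroup sylS); apply: Dp_min => H sH.
  have [C hC _] := special_cent sH; have [a [Aa _ sHa]] := special_der_cent1 sH hC.
  apply: subset_trans (special_pcore s sHa Aa) _.
  exact: pcore_sub_invariant_Sylow.
have sHE H (K : {group gT}) : H \in spec -> (forall s : nat, 'O_s(H) \subset K) -> H \subset K.
  move=> sH sK; rewrite -(nilpotent_Fitting (special_nil sH)) FittingEgen gen_subG.
  by apply/bigcupsP=> s _.
(* [D] is generated by the cores ['O_r(H)]: for [r = s] they lie in [Dp s], and for [r != s] they
   centralise it. *)
have nDp (s : nat) : Dp s <| D.
  rewrite /normal; apply/andP; split.
    by apply: Dp_min => H sH; apply: subset_trans (pcore_sub _ _) (sHD _ sH).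
  apply: subset_trans (der_special p_pr abelA nGA coGA d) _.
  apply: (gen_special_sub (K := 'N(Dp s)%G)) => H sH; apply: sHE => // r.
  have [-> | neq_rs] := eqVneq r s; first exact: subset_trans (sDp _ _ sH) (normG _).
  apply: subset_trans (cent_sub _); rewrite centsC; apply: (Dp_min s 'C('O_r(H))%G) => K sK.
  by apply: special_pcore_cents; rewrite // eq_sym.
apply: nilpotentS (Fitting_nil D); apply: subset_trans (der_special p_pr abelA nGA coGA d) _.
apply: (gen_special_sub (K := 'F(D)%G)) => H sH; apply: sHE => // s.
exact: subset_trans (sDp s H sH) (Fitting_max (nDp s) (pgroup_nil (pDp s))).
Qed.

End NilpotentDerived.

(** Induction on [j] by the three subgroups lemma modulo the target term. *)
Lemma lcn_comm (gT : finGroupType) (G : {group gT}) i j :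
  (0 < i)%N -> (0 < j)%N -> [~: 'L_i(G), 'L_j(G)] \subset 'L_(i + j)(G).
Proof.
case: i j => // i [|j] // _ _; elim: j i => [|j IH] i; first by rewrite addn1.
have -> : (i.+1 + j.+2 = (i + j).+3)%N by lia.
set N := 'L_(i + j).+3(G).
have nN n : 'L_n(G) \subset 'N(N).
  by apply: subset_trans (lcn_sub _ _) (normal_norm (lcn_normal _ _)).
have nNG : G \subset 'N(N) := normal_norm (lcn_normal _ _).
have nRN m n : [~: 'L_m(G), 'L_n(G)] \subset 'N(N) by rewrite comm_subG.
have nRG m : [~: 'L_m(G), G] \subset 'N(N) by rewrite comm_subG.
rewrite commGC lcnSn -quotient_sub1 ?comm_subG // !quotientR //.
have trivRN (X Y Z : {group gT}) : X \subset 'N(N) -> Y \subset 'N(N) ->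
    Z \subset 'N(N) -> [~: X, Y, Z] \subset N -> [~: X / N, Y / N, Z / N] = 1.
  by move=> nX nY nZ sN; rewrite -!quotientR ?comm_subG //; apply: quotientS1.
have sR1: [~: G, 'L_i.+1(G)] \subset 'L_i.+2(G) by rewrite commGC.
have := subset_trans (commSg _ sR1) (IH i.+1).
rewrite addSn addnS -addSn => /(trivRN G _ _ nNG (nN _) (nN _)) R1.
have := subset_trans (commSg G (IH i)) (lcnSnS _ _).
rewrite addSn addnS => /(trivRN _ _ G (nN _) (nN _) nNG) R2.
by rewrite (three_subgroup R1 R2).
Qed.

(** * The associated Lie ring acting on its dual *)

Section LieRepresentations.

Local Open Scope ring_scope.

Lemma zspan_word_eq0 (R : nzRingType) (X : R -> Prop) m s :
    (forall t, word X t -> size t = m -> \prod_(x <- t) x = 0) ->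
  word (zspan X) s -> size s = m -> \prod_(x <- s) x = 0.
Proof.
move=> X0 Xs size_s; suff gen (t u : seq R) : word X t -> word (zspan X) u ->
    (size t + size u = m)%N -> \prod_(x <- t) x * \prod_(x <- u) x = 0.
  by rewrite -(gen [::] s) // big_nil mul1r.
elim: u t => [|x u IH] t Xt; first by rewrite big_nil mulr1 addn0 => _; apply: X0.
case/word_cons=> Xx Xu size_tu; rewrite big_cons mulrA.
set U := \prod_(_ <- u) _; move: size_tu; rewrite [size (x :: u)]/= => size_tu; move: x Xx.
apply: (zspan_map (f := fun x => \prod_(y <- t) y * x * U) (P := fun z => z = 0)).
- by move=> x y; rewrite mulrBr mulrBl.
- by split=> // x y -> ->; rewrite subrr.
move=> x Xx; have := IH (rcons t x); rewrite -cats1 big_cat big_seq1; apply=> //.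
  by apply/word_cat; split=> //; apply/word_cons.
by rewrite size_cat addn1 addSnnS.
Qed.

(** * Eigenspaces of [A] on operators graded by the lower central series *)

Section GradedRepresentation.

Variables (F : fieldType) (R : algType F) (gT : finGroupType) (D A : {group gT}) (n : nat).
Local Notation p := n.+1.
Variables (T : nat -> gT -> R) (rho : gT -> R -> R) (w : F).

Hypotheses (p_pr : prime p) (abelA : (p.-abelem A)%g) (nDA : A \subset 'N(D)%g).
Hypotheses (coDA : coprime #|D| #|A|) (solD : solvable D).
Hypotheses (prim_w : p.-primitive_root w) (pF : p%:R != 0 :> F).

Hypothesis repM : forall j x y, (0 < j)%N -> x \in 'L_j(D)%g -> y \in 'L_j(D)%g ->
  T j (x * y)%g = T j x + T j y.
Hypothesis rep0 : forall j x, (0 < j)%N -> x \in 'L_j.+1(D)%g -> T j x = 0.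
Hypothesis rep_lie : forall i j x y, (0 < i)%N -> (0 < j)%N ->
  x \in 'L_i(D)%g -> y \in 'L_j(D)%g -> lie (T i x) (T j y) = T (i + j) [~ y, x]%g.
Hypothesis rhoB : forall a u v, rho a (u - v) = rho a u - rho a v.
Hypothesis rhoZ : forall a c u, rho a (c *: u) = c *: rho a u.
Hypothesis rhoM : forall a u v, a \in A -> rho a (u * v) = rho a u * rho a v.
Hypothesis rho1 : forall u, rho 1%g u = u.
Hypothesis rhoG : forall a b u, a \in A -> b \in A -> rho (a * b)%g u = rho b (rho a u).
Hypothesis rhoT : forall a j x, a \in A -> (0 < j)%N -> x \in 'L_j(D)%g ->
  rho a (T j x) = T j (x ^ a)%g.

(** Scalars are included so that the additive spans are subspaces over [F]. *)
Definition Tgen (X : {set gT}) (r : R) : Prop :=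
  exists j x c, [/\ (0 < j)%N, x \in X, x \in 'L_j(D)%g & r = c *: T j x].

Definition Tspan X := zspan (Tgen X).

Lemma TspanS (X Y : {set gT}) r : X \subset Y -> Tspan X r -> Tspan Y r.
Proof.
move=> sXY; apply: zspan_sub => _ [j [x [c [j0 Xx Lx ->]]]].
by exists j, x, c; rewrite (subsetP sXY).
Qed.

Lemma TspanZ X c r : Tspan X r -> Tspan X (c *: r).
Proof.
apply: (zspan_map (f := fun r => c *: r)) => [u v||].
- exact: scalerBr.
- exact: zspan_closed.
move=> _ [j [x [b [j0 Xx Lx ->]]]]; apply: zspan1; exists j, x, (c * b).
by rewrite scalerA.
Qed.

Lemma lcn_conj a j x : a \in A -> x \in 'L_j(D)%g -> (x ^ a)%g \in 'L_j(D)%g.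
Proof.
by move=> Aa Lx; rewrite memJ_norm // (subsetP _ a Aa) // (char_norm_trans (lcn_char _ _)).
Qed.

Lemma Tspan_rho (X : {group gT}) a r :
  A \subset 'N(X)%g -> a \in A -> Tspan X r -> Tspan X (rho a r).
Proof.
move=> nXA Aa; apply: (zspan_map (f := rho a)) => [u v||].
- exact: rhoB.
- exact: zspan_closed.
move=> _ [j [x [c [j0 Xx Lx ->]]]]; apply: zspan1; exists j, (x ^ a)%g, c.
by rewrite rhoZ rhoT // lcn_conj // memJ_norm // (subsetP nXA).
Qed.

Lemma Tspan_lie (X Y : {group gT}) r s :
  Tspan X r -> Tspan Y s -> Tspan [~: X, Y]%g (lie r s).
Proof.
move=> Xr Ys; move: r Xr.
apply: (zspan_map (f := fun r => lie r s)) => [u v||].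
- exact: lieBl.
- exact: zspan_closed.
move=> _ [i [x [c [i0 Xx Lx ->]]]]; move: s Ys.
apply: (zspan_map (f := fun s => lie (c *: T i x) s)) => [u v||].
- exact: lieBr.
- exact: zspan_closed.
move=> _ [j [y [b [j0 Yy Ly ->]]]].
have -> : lie (c *: T i x) (b *: T j y) = (c * b) *: lie (T i x) (T j y).
  rewrite /lie -!scalerAl -!scalerAr !scalerA scalerBr.
  by rewrite [b * c]mulrC.
rewrite rep_lie //; apply: zspan1; exists (i + j)%N, [~ y, x]%g, (c * b); split=> //.
- by rewrite addn_gt0 i0.
- by rewrite commGC mem_commg.
by rewrite addnC (subsetP (lcn_comm D j0 i0)) // mem_commg.
Qed.

Lemma rep1 j : (0 < j)%N -> T j 1%g = 0.
Proof. by move=> j0; apply: rep0. Qed.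

Lemma Tspan1 r : Tspan 1%g r -> r = 0.
Proof.
apply: zspan_eq0 => _ [j [x [c [j0 /set1P-> _ ->]]]].
by rewrite rep1 ?scaler0.
Qed.

Lemma rho_sum a (I : Type) (s : seq I) P f :
  rho a (\sum_(i <- s | P i) f i) = \sum_(i <- s | P i) rho a (f i).
Proof.
have rho0: rho a 0 = 0 by rewrite -[X in rho a X](subrr 0) rhoB subrr.
have rhoN u : rho a (- u) = - rho a u by rewrite -[- u]sub0r rhoB rho0 sub0r.
have rhoD u v : rho a (u + v) = rho a u + rho a v.
  by rewrite -{1}[v]opprK rhoB rhoN opprK.
exact: (big_morph _ rhoD rho0).
Qed.

(* The average over [B] kills the image of [[Y, B]], and [Y = [Y, B] C_Y(B)] by coprime action. *)
Lemma Tspan_fix (X B : {group gT}) r :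
    X \subset D -> B \subset A -> A \subset 'N(X)%g -> Tspan X r ->
    (forall b, b \in B -> rho b r = r) ->
  Tspan 'C_X(B)%g r.
Proof.
move=> sXD sBA nXA Xr fix_r.
have pB: (p.-group B)%g := pgroupS sBA (abelem_pgroup abelA).
have BF: #|B|%:R != 0 :> F.
  by have [m ->] := p_natP pB; rewrite natrX expf_neq0.
suff: Tspan 'C_X(B)%g (#|B|%:R^-1 *: \sum_(b in B) rho b r).
  rewrite (eq_bigr (fun=> r)) // sumr_const -scaler_nat scalerA mulVf //.
  by rewrite scale1r.
apply: TspanZ; move: r Xr {fix_r}.
apply: (zspan_map (f := fun r => \sum_(b in B) rho b r)) => [u v||].
- by rewrite -sumrB; apply: eq_bigr => b _; apply: rhoB.
- exact: zspan_closed.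
move=> _ [j [x [c [j0 Xx Lx ->]]]].
rewrite (eq_bigr (fun b => c *: rho b (T j x))) => [|b _]; last exact: rhoZ.
rewrite -scaler_sumr; apply: TspanZ.
have rho_T b y : b \in B -> y \in 'L_j(D)%g -> rho b (T j y) = T j (y ^ b)%g.
  by move=> /(subsetP sBA) Ab Ly; apply: rhoT.
(* [T j] is additive on ['L_j(D)], so coprime action is applied to this intersection. *)
pose Y := (X :&: 'L_j(D))%G.
have nYB: B \subset 'N(Y)%g.
  apply: subset_trans sBA _; rewrite normsI //.
  exact: char_norm_trans (lcn_char _ _) nDA.
have sYD: Y \subset D by rewrite subIset ?sXD.
have sYL: Y \subset 'L_j(D)%g by apply: subsetIr.
have defY: Y \subset ([~: Y, B] * 'C_Y(B))%g.
  apply: coprime_cent_prod => //; last exact: solvableS solD.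
  by rewrite (coprimegS sBA) // (coprimeSg sYD).
have sRY: [~: Y, B]%g \subset Y by rewrite commg_subl.
have avg0 v : v \in [~: Y, B]%g -> \sum_(b in B) rho b (T j v) = 0.
  case/gen_prodgP=> m [f Rf ->].
  have Lf i : f i \in 'L_j(D)%g by rewrite (subsetP sYL) // (subsetP sRY) // mem_gen.
  pose P v := v \in 'L_j(D)%g /\ \sum_(b in B) rho b (T j v) = 0.
  suff [] : P (\prod_(i < m) f i)%g by [].
  elim/big_ind: _ => [|u v' [Lu su] [Lv sv]|i _].
  - by split=> //; rewrite rep1 // big1 // => b Bb; rewrite -(rep1 j0) rho_T // conj1g.
  - split; first exact: groupM.
    rewrite (eq_bigr (fun b => rho b (T j u) + rho b (T j v'))) => [|b Bb].
      by rewrite big_split /= su sv addr0.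
    by rewrite !rho_T ?groupM // conjMg repM // lcn_conj // (subsetP sBA).
  split=> //; case/imset2P: (Rf i) => y b Yy Bb Dfi.
  have Ly: y \in 'L_j(D)%g := subsetP sYL y Yy.
  have Lyb e : e \in B -> (y ^ e)%g \in 'L_j(D)%g by move=> Be; rewrite lcn_conj // (subsetP sBA).
  rewrite Dfi commgEl.
  (* On a generator [[~ y, b]] the average is a difference of two sums over [B] that agree after a
     translation by [b]. *)
  rewrite (eq_bigr (fun e => rho (b * e)%g (T j y) - rho e (T j y))) => [|e Be].
    rewrite sumrB (reindex_inj (mulgI b^-1)%g) /=.
    rewrite (eq_big (fun e => e \in B) (fun e => rho e (T j y))) ?subrr // => e.
      by rewrite groupMl ?groupV.
    by rewrite mulKVg.
  have TV z : z \in 'L_j(D)%g -> T j z^-1%g = - T j z.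
    move=> Lz; apply/eqP; rewrite -subr_eq0 opprK -repM ?groupV // mulVg.
    by rewrite rep1.
  by rewrite repM ?groupV ?Lyb // TV // [- _ + _]addrC rhoB rhoG ?(subsetP sBA) // (rho_T b) //.
have: x \in ([~: Y, B] * 'C_Y(B))%g by rewrite (subsetP defY) // inE Xx.
case/mulsgP=> v y Rv /setIP[Yy Cy] Dx.
have Ly: y \in 'L_j(D)%g := subsetP sYL y Yy.
have Lv: v \in 'L_j(D)%g by rewrite (subsetP sYL) // (subsetP sRY).
have yb b : b \in B -> (y ^ b)%g = y.
  by move=> Bb; rewrite conjgE (centP Cy b Bb) mulKg.
rewrite Dx (eq_bigr (fun b => rho b (T j v) + T j y)) => [|b Bb]; last first.
  by rewrite !rho_T ?groupM // conjMg yb // repM // lcn_conj // (subsetP sBA).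
rewrite big_split /= avg0 // add0r sumr_const -scaler_nat.
apply: zspan1; exists j, y, #|B|%:R; split=> //.
by rewrite inE Cy (subsetP (subsetIl _ _) _ Yy).
Qed.

(** All functions serve as labels, not only characters of [A]: their number is [p ^ #|A|] at once,
    and the label of a bracket is a pointwise sum modulo [p]. *)
Definition eig (e : {ffun 'I_#|A| -> 'I_p}) (r : R) :=
  forall i, rho (enum_val i) r = w ^+ e i *: r.

Lemma eig_lie e f r s : eig e r -> eig f s -> eig (e + f) (lie r s).
Proof.
move=> er fs i; rewrite /lie rhoB !rhoM ?enum_valP // er fs ffunE /= (prim_expr_mod prim_w) exprD.
by rewrite -!scalerAl -!scalerAr !scalerA scalerBr [_ * w ^+ e i]mulrC.
Qed.

Lemma eig_fix e r i : eig e r -> e i = 0 -> rho (enum_val i) r = r.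
Proof. by move=> er e0; rewrite er e0 expr0 scale1r. Qed.

(** This is [p] times the projection onto the eigenspace of [a] for [w ^+ i]. *)
Definition proj a i r : R := \sum_(j < p) w ^- (i * j) *: rho (a ^+ j)%g r.

Lemma rho_proj a i r : a \in A -> rho a (proj a i r) = w ^+ i *: proj a i r.
Proof.
move=> Aa; pose g j := w ^- (i * j) *: rho (a ^+ j)%g r.
have [_ expA] := elimT (abelemP p_pr) abelA.
have w_neq0 : w != 0.
  apply/eqP=> w0; have := prim_expr_order prim_w.
  by rewrite w0 expr0n => /eqP; rewrite eq_sym oner_eq0.
have gp: g p = g 0%N.
  by rewrite /g expA // muln0 mulnC exprM (prim_expr_order prim_w) expr1n.
rewrite /proj rho_sum (eq_bigr (fun j : 'I_p => w ^+ i *: g j.+1)) => [|j _].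
  rewrite -scaler_sumr; congr (_ *: _); rewrite big_ord_recr gp [RHS]big_ord_recl /=.
  by rewrite addrC.
rewrite rhoZ -rhoG ?groupX // -expgSr /g mulnS exprD invfM scalerA mulrA mulfV ?mul1r //.
by rewrite expf_neq0.
Qed.

(** For nonzero [j] the coefficients of [rho (a ^+ j)] add up to a vanishing geometric sum. *)
Lemma sum_proj a r : \sum_(i < p) proj a i r = p%:R *: r.
Proof.
rewrite /proj exchange_big (bigD1 ord0) //= [X in _ + X]big1 => [|j j_neq0].
  rewrite addr0 (eq_bigr (fun=> r)) => [|i _]; first by rewrite sumr_const card_ord scaler_nat.
  by rewrite muln0 invr1 scale1r expg0 rho1.
rewrite -scaler_suml; set c := \sum_(i < p) _.
suff -> : c = 0 by rewrite scale0r.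
have wj_neq1 : (w ^+ j)^-1 != 1.
  rewrite invr_eq1 -(prim_order_dvd prim_w) gtnNdvd //.
  by rewrite lt0n.
apply: (mulfI (x := (w ^+ j)^-1 - 1)); first by rewrite subr_eq0.
rewrite mulr0 /c (eq_bigr (fun i : 'I_p => (w ^+ j)^-1 ^+ i)) => [|i _].
  by rewrite -subrX1 exprVn -exprM mulnC exprM (prim_expr_order prim_w) expr1n invr1 subrr.
by rewrite exprVn -exprM mulnC.
Qed.

Lemma Tspan_proj (X : {group gT}) a i r :
  A \subset 'N(X)%g -> a \in A -> Tspan X r -> Tspan X (proj a i r).
Proof.
move=> nXA Aa Xr; apply: zclosed_sum => [|j _]; first exact: zspan_closed.
by apply: TspanZ; apply: Tspan_rho; rewrite ?groupX.
Qed.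

Lemma Tspan_eig (X : {group gT}) r : A \subset 'N(X)%g -> Tspan X r ->
  zspan (fun s => Tspan X s /\ exists e, eig e s) r.
Proof.
(* The elements of [A] are diagonalised one after another; projecting for a new one keeps the
   earlier eigenvalues because [A] is abelian. *)
move=> nXA Xr; pose Q (l : seq 'I_#|A|) s := Tspan X s /\
  exists e : {ffun 'I_#|A| -> 'I_p}, {in l, forall i, rho (enum_val i) s = w ^+ e i *: s}.
suff gen l: zspan (Q l) r.
  move: (gen (enum 'I_#|A|)); apply: zspan_sub => s [Xs [e es]]; split=> //.
  by exists e => i; rewrite es // mem_enum.
elim: l => [|i l IH]; first by apply: zspan1; split=> //; exists 0 => j; rewrite in_nil.
move: r {Xr} IH; apply: zspan_min => [|r [Xr [e er]]]; first exact: zspan_closed.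
set a := enum_val i; have Aa: a \in A := enum_valP i.
have -> : r = \sum_(j < p) proj a j (p%:R^-1 *: r).
  by rewrite sum_proj scalerA mulfV // scale1r.
apply: zclosed_sum => [|j _]; first exact: zspan_closed.
apply: zspan1; split; first by apply: Tspan_proj => //; apply: TspanZ.
exists [ffun l => if l == i then j else e l] => l0.
rewrite inE ffunE; have [-> _ | _ /= ll] := eqVneq l0 i; first exact: rho_proj.
rewrite /proj rho_sum scaler_sumr; apply: eq_bigr => m _.
have Al: enum_val l0 \in A := enum_valP l0.
rewrite !rhoZ -rhoG ?groupX // //.
rewrite (centsP (abelem_abelian abelA) (a ^+ m)%g _ (enum_val l0)) ?groupX //.
by rewrite rhoG ?groupX // er // rhoZ !scalerA mulrC mulrA.
Qed.

(* The stabiliser in [A] of a nonzero eigenvector is the kernel of its character. *)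
Lemma eig_stab e r : r != 0 -> eig e r ->
  exists B : {group gT}, hyperplane p A B /\ forall b, b \in B -> rho b r = r.
Proof.
move=> r_neq0 er; pose B := [set b in A | rho b r == r].
have gB : group_set B.
  apply/group_setP; split=> [|b c]; first by rewrite inE group1 rho1 eqxx.
  rewrite !inE => /andP[Ab /eqP rb] /andP[Ac /eqP rc].
  by rewrite groupM //= rhoG // rb rc.
exists (Group gB); split=> [|b]; last by rewrite inE => /andP[_ /eqP].
have sBA: B \subset A by apply/subsetP=> b; rewrite inE => /andP[].
rewrite /hyperplane /= sBA /=; pose f a := e (enum_rank_in (group1 A) a).
have rf a : a \in A -> rho a r = w ^+ f a *: r.
  by move=> Aa; rewrite -{1}[a](enum_rankK_in (group1 A) Aa) er.
(* Each of the [p] fibres of the exponent on [A] lies in a coset of [B]. *)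
rewrite -sum1_card (partition_big f xpredT) //=.
rewrite -[X in (_ <= X * _)%N]card_ord -sum_nat_const; apply: leq_sum => j _.
rewrite sum1_card; pose Fj := [pred a | (a \in A) && (f a == j)].
change (#|Fj| <= #|B|)%N.
have [a0 /andP[/= Aa0 /eqP fa0] | F0] := pickP Fj; last by rewrite (eq_card0 F0).
rewrite -(card_rcoset B a0) subset_leq_card //; apply/subsetP=> a /andP[/= Aa /eqP fa].
rewrite mem_rcoset inE groupM ?groupV //= rhoG ?groupV // rf // fa -fa0 -rf //.
by rewrite -rhoG ?groupV // mulgV rho1.
Qed.

Variables (sp : seq {group gT}) (m c s : nat) (a0 : gT).
Hypotheses (size_sp : (size sp <= m)%N) (Aa0 : a0 \in A).
Hypothesis spD : forall H, H \in sp -> H \subset D /\ A \subset 'N(H)%g.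
Hypothesis sp_comm : forall H K B, H \in sp -> K \in sp -> hyperplane p A B ->
  exists2 J, J \in sp & ([~: H, K] :&: 'C(B))%g \subset J.
Hypothesis gen_sp : D \subset <<\bigcup_(H <- sp) H>>%g.
Hypothesis nil_sp : forall (H : {group gT}) t, H \in sp -> word (Tgen H) t -> size t = c ->
  \prod_(x <- t) x = 0.
Hypothesis sol_a0 : ('C_D(<[a0]>)^`(s) = 1)%g.

Let I := ('I_(size sp) * {ffun 'I_#|A| -> 'I_p})%type.
Let V (i : I) r := Tspan (nth 1%G sp i.1) r /\ eig i.2 r.
Let deg (i : I) : 'I_p := i.2 (enum_rank_in (group1 A) a0).

Let card_I : (#|{: I}| <= m * p ^ #|A|)%N.
Proof. by rewrite card_prod card_ord card_ffun !card_ord leq_mul2r size_sp orbT. Qed.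

Let nthP (i : I) : nth 1%G sp i.1 \in sp.
Proof. by rewrite mem_nth. Qed.

Let nilV i t : word (V i) t -> size t = c -> \prod_(x <- t) x = 0.
Proof.
move=> Vt; apply: (@zspan_word_eq0 _ (Tgen (nth 1%G sp i.1))) => [u|].
  exact: nil_sp.
by apply: sub_word Vt => x [].
Qed.

(** A nonzero bracket is an eigenvector, hence fixed by a hyperplane [B]; by [Tspan_fix] it comes
    from the fixed points of [B] in [[~: H, K]], which lie in a member of [sp]. *)
Let lieV i j x y : V i x -> V j y -> exists2 k, deg k = deg i + deg j & V k (lie x y).
Proof.
case: i j => [h e] [l f] [/= Hx ex] [/= Ky fy].
have sH : nth 1%G sp h \in sp by apply: (nthP (h, e)).
have sK : nth 1%G sp l \in sp by apply: (nthP (l, f)).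
have efz := eig_lie ex fy.
have [-> | z_neq0] := eqVneq (lie x y) 0.
  exists (h, e + f); first by rewrite /deg ffunE.
  split; first exact: zspan0.
  by move=> i; rewrite scaler0 -[X in rho _ X](subrr 0) rhoB subrr.
have [B [hB fixB]] := eig_stab z_neq0 efz.
have [J sJ sHKJ] := sp_comm sH sK hB.
have lt_j : (index J sp < size sp)%N by rewrite index_mem.
exists (Ordinal lt_j, e + f); first by rewrite /deg ffunE.
split=> //=; rewrite nth_index //; apply: (TspanS sHKJ).
have [[sHD nHA] [sKD nKA]] := (spD sH, spD sK).
apply: Tspan_fix fixB => //.
- by apply: subset_trans (commgSS sHD sKD) _; rewrite commg_subl normG.
- by case/andP: hB.
- by rewrite normsR.
exact: Tspan_lie.
Qed.

Let C0 := 'C_D(<[a0]>)%G.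

(** Degree 0 means fixed by [a0], so [Tspan_fix] applies to the group generated by [a0]. *)
Let letter0_span x : (exists2 i, deg i = 0 & V i x) -> Tspan C0 x.
Proof.
case=> -[h e] /= e0 [/= Hx ex]; have [sHD nHA] := spD (nthP (h, e)).
apply: (TspanS (X := 'C_(nth 1%G sp h)(<[a0]>)%g)); first exact: setSI.
apply: Tspan_fix => // [|b /cycleP[l ->]]; first by rewrite cycle_subG.
have fix0: rho a0 x = x.
  by have := eig_fix ex e0; rewrite enum_rankK_in.
by elim: l => [|l IH]; rewrite ?expg0 ?rho1 // expgS rhoG ?groupX // fix0.
Qed.

Let sol0 x : lie_der (fun x => exists2 i, deg i = 0 & V i x) s x -> x = 0.
Proof.
suff gen l y : lie_der (fun x => exists2 i, deg i = 0 & V i x) l y -> Tspan C0^`(l)%g y.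
  by move/gen; rewrite sol_a0; apply: Tspan1.
elim: l y => [|l IH] y; first exact: letter0_span.
case=> u [v [/IH Cu /IH Cv ->]]; rewrite dergSn.
exact: (Tspan_lie (X := C0^`(l)%G) (Y := C0^`(l)%G)).
Qed.

(** [T 1] turns a factorisation over the members of [sp] into a sum whose terms split into
    eigenvectors, so every letter is in the span of the family [V]. *)
Theorem graded_rep_nil t :
    {subset t <= D} -> size t = family_bound n (m * p ^ #|A|) c s ->
  \prod_(x <- t) T 1 x = 0.
Proof.
move=> sDt size_t; rewrite -(big_map (T 1) xpredT id).
apply: (@zspan_word_eq0 _ (fun x => exists i, V i x)); last by rewrite size_map size_t.
  move=> u; exact: (graded_family_nil (deg := deg) card_I nilV lieV sol0).
have T_H (H : {group gT}) x : H \in sp -> x \in H -> zspan (fun x => exists i, V i x) (T 1 x).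
  move=> sH Hx; have [sHD nHA] := spD sH.
  have Hx1: Tspan H (T 1 x).
    by apply: zspan1; exists 1%N, x, 1; rewrite scale1r (subsetP sHD).
  move: (Tspan_eig nHA Hx1); apply: zspan_sub => r [Hr [e er]].
  have lt_h : (index H sp < size sp)%N by rewrite index_mem.
  by exists (Ordinal lt_h, e); split; rewrite //= nth_index.
move=> _ /mapP[x /sDt Dx ->]; have := subsetP gen_sp x Dx.
case/gen_prodgP=> l [f sf Dfx].
have Hf i : exists2 H : {group gT}, H \in sp & f i \in H.
  move: (sf i); elim: (sp) => [|H q IH]; first by rewrite big_nil inE.
  rewrite big_cons => /setUP[Hfi | /IH[K qK Kfi]].
    by exists H; rewrite ?mem_head.
  by exists K; rewrite // inE qK orbT.
pose P v := v \in D /\ zspan (fun x => exists i, V i x) (T 1 v).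
suff: P x by case.
rewrite Dfx; elim/big_ind: _ => [|u v [Du Tu] [Dv Tv]|i _].
- by split=> //; rewrite rep1 //; apply: zspan0.
- split; first exact: groupM.
  by rewrite repM //; apply: zclosedD => //; apply: zspan_closed.
have [H sH Hfi] := Hf i; split; last exact: T_H sH Hfi.
by have [sHD _] := spD sH; apply: (subsetP sHD).
Qed.

End GradedRepresentation.

(** * The dual of the lower central factors as a representation *)

Section DualSpace.

Variables (F : finFieldType) (gT : finGroupType) (D : {group gT}) (N : nat).

Local Notation family := {ffun 'I_N.+1 * gT -> F^o}.

(* Level [i] is the dual of ['L_i.+1(D) / 'L_i.+2(D)], extended by 0 outside ['L_i.+1(D)]. *)
Definition dualb (phi : {ffun 'I_N.+1 * gT -> F}) :=
  [forall i : 'I_N.+1, forall y in 'L_i.+1(D)%g, forall z in 'L_i.+1(D)%g,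
     phi (i, y * z)%g == phi (i, y) + phi (i, z)] &&
  [forall i : 'I_N.+1, forall y,
     (y \in 'L_i.+2(D)%g) || (y \notin 'L_i.+1(D)%g) ==> (phi (i, y) == 0)].

(** As [F] is finite, the families satisfying [dualb] form a finite list; by [mem_dual] its span
    adds nothing. *)
Definition dual : {vspace family} :=
  <<[seq (phi : family) | phi <- enum (predT : pred {ffun 'I_N.+1 * gT -> F}) & dualb phi]>>%VS.

Lemma dualbP (phi : {ffun 'I_N.+1 * gT -> F}) : reflect
  [/\ forall (i : 'I_N.+1) y z, y \in 'L_i.+1(D)%g -> z \in 'L_i.+1(D)%g ->
        phi (i, y * z)%g = phi (i, y) + phi (i, z),
      forall (i : 'I_N.+1) y, y \in 'L_i.+2(D)%g -> phi (i, y) = 0 &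
      forall (i : 'I_N.+1) y, y \notin 'L_i.+1(D)%g -> phi (i, y) = 0]
  (dualb phi).
Proof.
apply: (iffP andP) => [[/forallP phiM /forallP phi0] | [phiM phi0 phiD]].
  split=> [i y z Ly Lz | i y Ly | i y Ly].
  - have /forall_inP/(_ y Ly)/forall_inP/(_ z Lz)/eqP := phiM i; exact.
  - by have /forallP/(_ y)/implyP/(_ _)/eqP -> := phi0 i; rewrite ?Ly.
  - by have /forallP/(_ y)/implyP/(_ _)/eqP -> := phi0 i; rewrite ?Ly ?orbT.
split; apply/forallP=> i.
  by apply/forall_inP=> y Ly; apply/forall_inP=> z Lz; rewrite phiM.
by apply/forallP=> y; apply/implyP=> /orP[/phi0 -> | /phiD ->].
Qed.

Lemma mem_dual (phi : family) : (phi \in dual) = dualb phi.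
Proof.
apply/idP/idP=> [dphi | dphi]; last first.
  by apply: memv_span; apply/mapP; exists phi; rewrite // mem_filter dphi mem_enum.
pose S := in_tuple
  [seq (phi : family) | phi <- enum (predT : pred {ffun 'I_N.+1 * gT -> F}) & dualb phi].
rewrite (coord_span (X := S) dphi).
elim/big_ind: _ => [|f g /dualbP[fM f0 fD] /dualbP[gM g0 gD]|i _].
- by apply/dualbP; split=> *; rewrite !ffunE ?addr0.
- apply/dualbP; split=> [i y z Ly Lz | i y Ly | i y Ly]; rewrite !ffunE.
  + by rewrite fM // gM // addrACA.
  + by rewrite f0 // g0 // addr0.
  + by rewrite fD // gD // addr0.
set c := coord _ _ _; set f := nth _ _ _.
have /dualbP[fM f0 fD] : dualb f.
  have : f \in (S : seq family) by apply: mem_nth.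
  by case/mapP=> g; rewrite mem_filter => /andP[dg _] ->.
apply/dualbP; split=> [j y z Ly Lz | j y Ly | j y Ly]; rewrite !ffunE.
- by rewrite fM // scalerDr.
- by rewrite f0 // scaler0.
- by rewrite fD // scaler0.
Qed.

Local Notation W := (subvs_of dual).

Section Values.

Variable u : W.
Local Notation phi := (vsval u : {ffun 'I_N.+1 * gT -> F}).

Let dphi : dualb phi. Proof. by rewrite -mem_dual; apply: subvsP. Qed.

Lemma dualM (i : 'I_N.+1) y z : y \in 'L_i.+1(D)%g -> z \in 'L_i.+1(D)%g ->
  phi (i, y * z)%g = phi (i, y) + phi (i, z).
Proof. by case/dualbP: dphi => + _ _; apply. Qed.

Lemma dual0 (i : 'I_N.+1) y : y \in 'L_i.+2(D)%g -> phi (i, y) = 0.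
Proof. by case/dualbP: dphi => _ + _; apply. Qed.

Lemma dual_out (i : 'I_N.+1) y : y \notin 'L_i.+1(D)%g -> phi (i, y) = 0.
Proof. by case/dualbP: dphi => _ _; apply. Qed.

Lemma dual1 i : phi (i, 1%g) = 0. Proof. exact: dual0. Qed.

Lemma dualV (i : 'I_N.+1) y : y \in 'L_i.+1(D)%g -> phi (i, y^-1)%g = - phi (i, y).
Proof.
move=> Ly; apply/eqP; rewrite -subr_eq0 opprK -dualM ?groupV // mulVg.
by rewrite dual1.
Qed.

Lemma dual_mod (i : 'I_N.+1) y z : y \in 'L_i.+1(D)%g -> z \in 'L_i.+2(D)%g ->
  phi (i, y * z)%g = phi (i, y).
Proof.
by move=> Ly Lz; rewrite dualM ?(subsetP (lcn_subS _ _) z Lz) // (dual0 Lz) addr0.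
Qed.

Lemma dualJ (i : 'I_N.+1) y x : y \in 'L_i.+1(D)%g -> x \in D ->
  phi (i, y ^ x)%g = phi (i, y).
Proof.
move=> Ly Dx; rewrite -[(y ^ x)%g](mulKVg y) -commgEl dual_mod //.
by rewrite (subsetP (lcnSnS _ _)) // mem_commg.
Qed.

Lemma dual_gen0 (i : 'I_N.+1) (X : {set gT}) y :
    <<X>>%g \subset 'L_i.+1(D)%g -> (forall x, x \in X -> phi (i, x) = 0) ->
  y \in <<X>>%g -> phi (i, y) = 0.
Proof.
move=> sXL X0 /gen_prodgP[m [f Xf ->]].
suff [] : (\prod_(j < m) f j)%g \in <<X>>%g /\ phi (i, \prod_(j < m) f j)%g = 0 by [].
elim/big_ind: _ => [|v z [Lv v0] [Lz z0]|j _]; first by rewrite group1 dual1.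
  by rewrite groupM // dualM ?(subsetP sXL) // v0 z0 addr0.
by rewrite mem_gen // X0.
Qed.

End Values.

(** Level [i] lives on ['L_i.+1(D)], so for [x] in ['L_j(D)] the commutator lies in
    ['L_(i + j).+1(D)], which is level [i + j]. *)
Definition opT_fun (j : nat) (x : gT) (phi : family) : family :=
  [ffun iy : 'I_N.+1 * gT => if (iy.1 + j < N.+1)%N && (iy.2 \in 'L_(iy.1).+1(D)%g)
    then phi (inord (iy.1 + j), [~ iy.2, x]%g) else 0].

Definition opA_fun (a : gT) (phi : family) : family :=
  [ffun iy : 'I_N.+1 * gT => phi (iy.1, iy.2 ^ a)%g].

(** The projection makes the operator total; by [opT_val] it changes nothing for [0 < j] and [x] in
    ['L_j(D)]. *)
Definition opT j x (u : W) : W := vsproj dual (opT_fun j x (vsval u)).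
Definition opA a (u : W) : W := vsproj dual (opA_fun a (vsval u)).

Lemma opT_linear j x : linear (opT j x).
Proof.
move=> c u v; rewrite /opT -linearP; congr (vsproj _ _).
by apply/ffunP=> iy; rewrite linearP !ffunE; case: ifP; rewrite ?scaler0 ?addr0.
Qed.

Lemma opA_linear a : linear (opA a).
Proof.
move=> c u v; rewrite /opA -linearP; congr (vsproj _ _).
by apply/ffunP=> iy; rewrite linearP !ffunE.
Qed.

HB.instance Definition _ j x := GRing.isLinear.Build F W W _ (opT j x) (opT_linear j x).
HB.instance Definition _ a := GRing.isLinear.Build F W W _ (opA a) (opA_linear a).

Lemma opT_val (j : nat) x (u : W) : (0 < j)%N -> x \in 'L_j(D)%g ->
  vsval (opT j x u) = opT_fun j x (vsval u).
Proof.
move=> j0 Lx; rewrite vsprojK // mem_dual; apply/dualbP.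
have val_inord (i : 'I_N.+1) : (i + j < N.+1)%N -> (inord (i + j) : 'I_N.+1) = (i + j)%N :> nat.
  by apply: inordK.
have Dx: x \in D := subsetP (lcn_sub _ _) x Lx.
have Lc (i m : nat) y : y \in 'L_i.+1(D)%g -> m = (i + j)%N -> [~ y, x]%g \in 'L_m.+1(D)%g.
  by move=> Ly ->; rewrite -addSn (subsetP (lcn_comm D _ j0)) // mem_commg.
split=> [i y z Ly Lz | i y Ly | i y Ly]; rewrite !ffunE /=.
- rewrite groupM // Ly Lz !andbT; case: ifP => [lt_ij | _]; last by rewrite addr0.
  have Dz: z \in D := subsetP (lcn_sub _ _) z Lz.
  have vij := val_inord _ lt_ij.
  have [Lyx Lzx] := (Lc i _ y Ly vij, Lc i _ z Lz vij).
  rewrite commMgJ dualM ?dualJ // memJ_norm //.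
  exact: subsetP (normal_norm (lcn_normal _ _)) z Dz.
- case: ifP => // /andP[lt_ij Ly1]; rewrite dual0 // (Lc i.+1) // ?addSn ?val_inord //.
- by rewrite (negPf Ly) andbF.
Qed.


Lemma opA_val a (u : W) : a \in 'N(D)%g -> vsval (opA a u) = opA_fun a (vsval u).
Proof.
move=> nDa; rewrite vsprojK // mem_dual; apply/dualbP.
have La i y : ((y ^ a)%g \in 'L_i(D)%g) = (y \in 'L_i(D)%g).
  apply: memJ_norm; have := char_norm_trans (lcn_char i D) (_ : <[a]>%g \subset 'N(D)%g).
  by rewrite !cycle_subG; apply.
split=> [i y z Ly Lz | i y Ly | i y Ly]; rewrite !ffunE /=.
- by rewrite conjMg dualM ?La.
- by rewrite dual0 ?La.
- by rewrite dual_out ?La.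
Qed.

Hypothesis dual_proper : (0 < dim W)%N.

Local Notation R := (lfun_algType dual_proper).

Definition ev (r : R) (u : W) : W := (r : 'End(W)) u.

(** Words act from left to right, which is why [[~ y, x]] appears in [Tend_lie]. *)
Lemma evM r s u : ev (r * s) u = ev s (ev r u).
Proof. exact: comp_lfunE. Qed.

Lemma evB r s u : ev (r - s) u = ev r u - ev s u.
Proof. by rewrite /ev add_lfunE opp_lfunE. Qed.

Lemma evD r s u : ev (r + s) u = ev r u + ev s u.
Proof. exact: add_lfunE. Qed.

Lemma evZ c r u : ev (c *: r) u = c *: ev r u.
Proof. exact: scale_lfunE. Qed.

Lemma ev0 u : ev 0 u = 0.
Proof. exact: zero_lfunE. Qed.

Lemma ev_inj (r s : R) : (forall u, ev r u = ev s u) -> r = s.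
Proof. by move=> eq_rs; apply/lfunP. Qed.

Definition Tend (j : nat) (x : gT) : R := linfun (opT j x).
Definition Aend (a : gT) : 'End(W) := linfun (opA a).
Definition conjend (a : gT) (r : R) : R := (Aend a^-1%g \o (r : 'End(W)) \o Aend a)%VF.

Lemma ev_T j x u : ev (Tend j x) u = opT j x u.
Proof. exact: lfunE. Qed.

Lemma ev_conj a r u : ev (conjend a r) u = opA a^-1%g (ev r (opA a u)).
Proof. by rewrite /ev !comp_lfunE !lfunE. Qed.

Lemma val_eq (u v : W) :
    (forall (i : 'I_N.+1) y, y \in 'L_i.+1(D)%g -> vsval u (i, y) = vsval v (i, y)) ->
  u = v.
Proof.
move=> eq_uv; apply: val_inj; apply/ffunP=> -[i y] /=.
by have [/eq_uv // | Ly] := boolP (y \in 'L_i.+1(D)%g); rewrite !dual_out.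
Qed.

Lemma ev_T_val j x u (i k : 'I_N.+1) y : (0 < j)%N -> x \in 'L_j(D)%g ->
    y \in 'L_i.+1(D)%g -> k = (i + j)%N :> nat ->
  vsval (ev (Tend j x) u) (i, y) = vsval u (k, [~ y, x]%g).
Proof.
move=> j0 Lx Ly Dk; rewrite ev_T opT_val // ffunE /= -Dk ltn_ord Ly /=.
by congr (vsval u (_, _)); apply: val_inj; rewrite /= inordK.
Qed.

Lemma ev_T_out j x u (i : 'I_N.+1) y : (0 < j)%N -> x \in 'L_j(D)%g ->
  (N < i + j)%N -> vsval (ev (Tend j x) u) (i, y) = 0.
Proof. by move=> j0 Lx lt_ij; rewrite ev_T opT_val // ffunE /= ltnNge lt_ij. Qed.

Lemma lcn_commS i j y x : (0 < j)%N -> y \in 'L_i.+1(D)%g -> x \in 'L_j(D)%g ->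
  [~ y, x]%g \in 'L_(i + j).+1(D)%g.
Proof.
by move=> j0 Ly Lx; rewrite -addSn (subsetP (lcn_comm D _ j0)) // mem_commg.
Qed.

Lemma Tend_M j x y : (0 < j)%N -> x \in 'L_j(D)%g -> y \in 'L_j(D)%g ->
  Tend j (x * y)%g = Tend j x + Tend j y.
Proof.
move=> j0 Lx Ly; apply: ev_inj => u; apply: val_eq => i z Lz.
rewrite evD linearD ffunE /=.
have [lt_ij | le_ij] := leqP (i + j).+1 N.+1; last by rewrite !ev_T_out ?groupM ?addr0.
pose k : 'I_N.+1 := Ordinal lt_ij.
rewrite !(@ev_T_val _ _ _ _ k) ?groupM // commgMJ.
have [Lzx Lzy] := (lcn_commS j0 Lz Lx, lcn_commS j0 Lz Ly).
have Dy: y \in D := subsetP (lcn_sub _ _) y Ly.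
rewrite dualM ?dualJ //; first by rewrite addrC.
by rewrite memJ_norm // (subsetP (normal_norm (lcn_normal _ _))).
Qed.

Lemma Tend_0 j x : (0 < j)%N -> x \in 'L_j.+1(D)%g -> Tend j x = 0.
Proof.
move=> j0 Lx; have Lx' : x \in 'L_j(D)%g := subsetP (lcn_subS _ _) x Lx.
apply: ev_inj => u; apply: val_eq => i z Lz; rewrite ev0 linear0 ffunE.
have [lt_ij | le_ij] := leqP (i + j).+1 N.+1; last by rewrite ev_T_out.
pose k : 'I_N.+1 := Ordinal lt_ij.
rewrite (@ev_T_val _ _ _ _ k) // dual0 //=.
by rewrite -addnS lcn_commS.
Qed.

Lemma Tend_V j x : (0 < j)%N -> x \in 'L_j(D)%g -> Tend j x^-1%g = - Tend j x.
Proof.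
move=> j0 Lx; apply/eqP; rewrite -subr_eq0 opprK -Tend_M ?groupV // mulVg.
by rewrite Tend_0.
Qed.

Lemma Tend_J j x d : (0 < j)%N -> x \in 'L_j(D)%g -> d \in D ->
  Tend j (x ^ d)%g = Tend j x.
Proof.
move=> j0 Lx Dd; have Lxd: [~ x, d]%g \in 'L_j.+1(D)%g.
  by rewrite (subsetP (lcnSnS _ _)) // mem_commg.
rewrite -[(x ^ d)%g](mulKVg x) -commgEl Tend_M ?(Tend_0 j0 Lxd) ?addr0 //.
exact: subsetP (lcn_subS _ _) _ Lxd.
Qed.

(** The Hall-Witt identity becomes additive under [u], which ignores conjugation by [D]. By [E1],
    [E2] and [E3] the inverted entries turn into signs, since [u] is additive in each entry of the
    commutators. *)
Lemma dual_Hall_Witt (u : W) (m : 'I_N.+1) i j l x y z :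
    (0 < i)%N -> (0 < j)%N -> m = (l + i + j)%N :> nat ->
    x \in 'L_i(D)%g -> y \in 'L_j(D)%g -> z \in 'L_l.+1(D)%g ->
  vsval u (m, [~ z, [~ y, x]]%g) = vsval u (m, [~ z, y, x]%g) - vsval u (m, [~ z, x, y]%g).
Proof.
move=> i0 j0 Dm Lx Ly Lz; have ij0: (0 < j + i)%N by rewrite addn_gt0 j0.
have leD k : 'L_k(D)%g \subset D := lcn_sub k D.
have [[Dx Dy] Dz] := ((subsetP (leD i) _ Lx, subsetP (leD j) _ Ly), subsetP (leD _) _ Lz).
have lt_l : (l < N.+1)%N by rewrite (leq_trans _ (ltn_ord m)) // Dm; lia.
have lt_lj : (l + j < N.+1)%N by rewrite (leq_trans _ (ltn_ord m)) // Dm; lia.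
have lt_li : (l + i < N.+1)%N by rewrite (leq_trans _ (ltn_ord m)) // Dm; lia.
pose kl := Ordinal lt_l; pose kj := Ordinal lt_lj; pose ki := Ordinal lt_li.
have Dmj : m = (kj + i)%N :> nat by rewrite Dm /=; lia.
have Dml : m = (kl + (j + i))%N :> nat by rewrite Dm /=; lia.
have LyV : (y^-1)%g \in 'L_j(D)%g by rewrite groupV.
have LzV : (z^-1)%g \in 'L_kl.+1(D)%g by rewrite groupV.
have LxV : (x^-1)%g \in 'L_i(D)%g by rewrite groupV.
have Lcomm a b s t : (0 < s)%N -> (0 < t)%N -> a \in 'L_s(D)%g -> b \in 'L_t(D)%g ->
    [~ a, b]%g \in 'L_(s + t)(D)%g.
  by move=> s0 t0 La Lb; rewrite (subsetP (lcn_comm D s0 t0)) // mem_commg.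
have E1: vsval u (m, [~ z, y^-1, x]%g) = - vsval u (m, [~ z, y, x]%g).
  rewrite -(@ev_T_val i x u kj m) ?lcn_commS // -(@ev_T_val j y^-1%g _ kl kj) //.
  rewrite Tend_V // /ev opp_lfunE linearN ffunE; congr (- _).
  rewrite -[LHS]/(vsval (ev (Tend j y) (ev (Tend i x) u)) (kl, z)).
  by rewrite (@ev_T_val j y _ kl kj) // (@ev_T_val i x u kj m) ?lcn_commS.
have E2: vsval u (m, [~ x, z^-1, y]%g) = vsval u (m, [~ z, x, y]%g).
  have Lzx := lcn_commS i0 LzV Lx.
  rewrite -(@ev_T_val j y u ki m) //; last by rewrite -invg_comm groupV.
  rewrite -invg_comm dualV // -(@ev_T_val i x _ kl ki) // dualV // opprK.
  by rewrite (@ev_T_val i x _ kl ki) // (@ev_T_val j y u ki m) ?lcn_commS.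
have E3: vsval u (m, [~ y, x^-1, z]%g) = vsval u (m, [~ z, [~ y, x]]%g).
  have Lyx := Lcomm _ _ _ _ j0 i0 Ly Lx.
  have Lxy : [~ x, y]%g \in 'L_(j + i)(D)%g by rewrite -invg_comm groupV.
  have -> : [~ y, x^-1]%g = ([~ x, y] ^ x^-1)%g.
    by rewrite !commgEl !conjgE !invgK !mulgA mulgV mul1g.
  have Lyx' : ([~ x, y] ^ x^-1)%g \in 'L_(j + i)(D)%g.
    by rewrite memJ_norm // (subsetP (normal_norm (lcn_normal _ _))) ?groupV.
  have Lzyx := lcn_commS ij0 Lz Lyx'.
  rewrite -[[~ _, z]%g]invg_comm dualV; last by rewrite Dml.
  rewrite -(@ev_T_val (j + i) ([~ x, y] ^ x^-1)%g u kl m) // Tend_J ?groupV //.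
  rewrite -[[~ x, y]%g]invg_comm Tend_V //.
  rewrite /ev opp_lfunE linearN ffunE opprK.
  by rewrite -[LHS]/(vsval (ev (Tend (j + i) [~ y, x]%g) u) (kl, z)) (@ev_T_val _ _ u kl m).
have := congr1 (fun v => vsval u (m, v)) (Hall_Witt_identity z y x); rewrite /=.
have L1 : [~ z, y^-1, x]%g \in 'L_m.+1(D)%g.
  have -> : m.+1 = (l.+1 + j + i)%N by rewrite Dm !addSn addnAC.
  by rewrite !Lcomm.
have L2 : [~ y, x^-1, z]%g \in 'L_m.+1(D)%g.
  have -> : m.+1 = (j + i + l.+1)%N.
    by rewrite Dm addnS [(j + i)%N]addnC [(i + j + l)%N]addnC addnA.
  by rewrite !Lcomm.
have L3 : [~ x, z^-1, y]%g \in 'L_m.+1(D)%g.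
  have -> : m.+1 = (i + l.+1 + j)%N by rewrite Dm addnS addSn [(i + l)%N]addnC.
  by rewrite !Lcomm ?addn_gt0 ?i0.
move: [~ z, y^-1, x]%g [~ y, x^-1, z]%g [~ x, z^-1, y]%g E1 E2 E3 L1 L2 L3.
move=> a b c E1 E2 E3 La Lb Lc.
have nL d v : d \in D -> v \in 'L_m.+1(D)%g -> (v ^ d)%g \in 'L_m.+1(D)%g.
  by move=> Dd Lv; rewrite memJ_norm // (subsetP (normal_norm (lcn_normal _ _))).
have [[Ly_a Lx_b] Lz_c] := (nL y a Dy La, nL x b Dx Lb, nL z c Dz Lc).
rewrite (dualM u (groupM Ly_a Lx_b) Lz_c) (dualM u Ly_a Lx_b).
rewrite (@dualJ u m a y) // (@dualJ u m b x) // (@dualJ u m c z) // dual1.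
rewrite E1 E2 E3 => /eqP; rewrite addrAC addrC addr_eq0 => /eqP->.
by rewrite opprD opprK.
Qed.

Lemma Tend_lie i j x y : (0 < i)%N -> (0 < j)%N -> x \in 'L_i(D)%g -> y \in 'L_j(D)%g ->
  lie (Tend i x) (Tend j y) = Tend (i + j) [~ y, x]%g.
Proof.
move=> i0 j0 Lx Ly; have ij0: (0 < i + j)%N by rewrite addn_gt0 i0.
have Lyx: [~ y, x]%g \in 'L_(i + j)(D)%g.
  by rewrite addnC (subsetP (lcn_comm D j0 i0)) // mem_commg.
apply: ev_inj => u; apply: val_eq => l z Lz.
rewrite /lie evB !evM linearB !ffunE.
have [lt_lij | le_lij] := leqP (l + i + j).+1 N.+1; last first.
  rewrite [RHS]ev_T_out ?addnA //.
  have out a b s t : (0 < s)%N -> (0 < t)%N -> a \in 'L_s(D)%g -> b \in 'L_t(D)%g ->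
      (N < l + s + t)%N -> vsval (ev (Tend s a) (ev (Tend t b) u)) (l, z) = 0.
    move=> s0 t0 La Lb lt_N; have [lt_ls | le_ls] := leqP (l + s).+1 N.+1.
      by rewrite (@ev_T_val _ _ _ _ (Ordinal lt_ls)) // ev_T_out.
    by rewrite ev_T_out.
  by rewrite !out ?subrr // addnAC.
pose m : 'I_N.+1 := Ordinal lt_lij.
have lt_lj : (l + j < N.+1)%N by lia.
have lt_li : (l + i < N.+1)%N by lia.
have Dmj : m = (l + j + i)%N :> nat by rewrite /= addnAC.
rewrite (@ev_T_val j y (ev (Tend i x) u) l (Ordinal lt_lj) z) //.
rewrite (@ev_T_val i x u (Ordinal lt_lj) m) ?lcn_commS //.
rewrite (@ev_T_val i x (ev (Tend j y) u) l (Ordinal lt_li) z) //.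
rewrite (@ev_T_val j y u (Ordinal lt_li) m) ?lcn_commS //.
rewrite (@ev_T_val (i + j) _ u l m) ?addnA //.
by rewrite (@dual_Hall_Witt u m i j l).
Qed.

Lemma conjend_B a r s : conjend a (r - s) = conjend a r - conjend a s.
Proof. by apply: ev_inj => u; rewrite !(ev_conj, evB) linearB. Qed.

Lemma conjend_Z a c r : conjend a (c *: r) = c *: conjend a r.
Proof. by apply: ev_inj => u; rewrite !(ev_conj, evZ) linearZ. Qed.

Lemma opA1 u : opA 1%g u = u.
Proof.
by apply: val_eq => i y Ly; rewrite opA_val ?group1 // ffunE /= conjg1.
Qed.

Lemma opAM a b u : a \in 'N(D)%g -> b \in 'N(D)%g -> opA (a * b)%g u = opA a (opA b u).
Proof.
move=> na nb; apply: val_eq => i y Ly.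
by rewrite !opA_val ?groupM // !ffunE /= conjgM.
Qed.

Lemma conjend_M a r s : a \in 'N(D)%g -> conjend a (r * s) = conjend a r * conjend a s.
Proof.
move=> na; apply: ev_inj => u; rewrite !(ev_conj, evM) -opAM ?groupV // mulgV.
by rewrite opA1.
Qed.

Lemma conjend_1 r : conjend 1%g r = r.
Proof. by apply: ev_inj => u; rewrite ev_conj invg1 !opA1. Qed.

Lemma conjend_G a b r : a \in 'N(D)%g -> b \in 'N(D)%g ->
  conjend (a * b)%g r = conjend b (conjend a r).
Proof.
by move=> na nb; apply: ev_inj => u; rewrite !ev_conj invMg !opAM ?groupV.
Qed.

Lemma conjend_T a j x : a \in 'N(D)%g -> (0 < j)%N -> x \in 'L_j(D)%g ->
  conjend a (Tend j x) = Tend j (x ^ a)%g.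
Proof.
move=> na j0 Lx; apply: ev_inj => u; apply: val_eq => i y Ly.
have La l z : ((z ^ a)%g \in 'L_l(D)%g) = (z \in 'L_l(D)%g).
  apply: memJ_norm; have := char_norm_trans (lcn_char l D) (_ : <[a]>%g \subset 'N(D)%g).
  by rewrite !cycle_subG; apply.
have Lya: (y ^ a^-1)%g \in 'L_i.+1(D)%g by rewrite -La conjgKV.
rewrite ev_conj opA_val ?groupV // ffunE /=.
have [lt_ij | le_ij] := leqP (i + j).+1 N.+1; last by rewrite !ev_T_out ?La.
pose k : 'I_N.+1 := Ordinal lt_ij.
rewrite !(@ev_T_val _ _ _ _ k) ?La // opA_val // ffunE /=.
by rewrite conjRg conjgKV.
Qed.

Lemma ev1 u : ev 1 u = u.
Proof. exact: id_lfunE. Qed.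

(** An operator from [H] takes a functional vanishing on [Y l.+1] to one vanishing on [Y l], so each
    letter moves the vanishing one step back along the chain. *)
Lemma word_vanish (H : {group gT}) (Y : nat -> {set gT}) t k (u : W) :
    word (Tgen D Tend H) t -> (forall l, [~: Y l, H]%g \subset Y l.+1) ->
    (forall (i : 'I_N.+1) y,
       y \in Y (k + size t)%N -> y \in 'L_i.+1(D)%g -> vsval u (i, y) = 0) ->
  forall (i : 'I_N.+1) y, y \in Y k -> y \in 'L_i.+1(D)%g ->
    vsval (ev (\prod_(x <- t) x) u) (i, y) = 0.
Proof.
move=> + sYH; elim: t k u => [|r t IH] k u.
  by move=> _ u0 i y; rewrite addn0 in u0; rewrite big_nil ev1; apply: u0.
case/word_cons=> [[j [x [c [j0 Hx Lx ->]]]] Xt] u0; rewrite big_cons => i y Yy Ly.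
rewrite evM; apply: (IH k) => // l z Yz Lz.
rewrite evZ linearZ ffunE.
have [lt_lj | le_lj] := leqP (l + j).+1 N.+1; last by rewrite ev_T_out ?scaler0.
rewrite (@ev_T_val _ _ _ _ (Ordinal lt_lj)) // u0 ?scaler0 ?lcn_commS //.
by rewrite /= addnS (subsetP (sYH _)) // mem_commg.
Qed.

(** Each ['L_i.+1(D)] is generated by its fixed points under hyperplanes, and from these the chain
    [Y] reaches the identity after [c] letters. *)
Lemma word_nil (p c : nat) (A H : {group gT}) t :
    prime p -> (p.-abelem A)%g -> A \subset 'N(D)%g -> coprime #|D| #|A| ->
    (forall B, hyperplane p A B -> exists Y : nat -> {set gT},
      [/\ 'C_D(B)%g \subset Y 0%N, Y c \subset [set 1%g] &
          forall l, [~: Y l, H]%g \subset Y l.+1]) ->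
  word (Tgen D Tend H) t -> size t = c -> \prod_(x <- t) x = 0.
Proof.
move=> p_pr abelA nDA coDA annY Ht size_t.
apply: ev_inj => u; apply: val_eq => i y Ly; rewrite ev0 linear0 ffunE.
have sLD : 'L_i.+1(D)%g \subset D := lcn_sub _ _.
have nLA : A \subset 'N('L_i.+1(D))%g := char_norm_trans (lcn_char _ _) nDA.
have sL := coprime_gen_cent p_pr abelA nLA (coprimeSg sLD coDA).
apply: dual_gen0 (subsetP sL y Ly).
  by rewrite gen_subG; apply/bigcupsP=> B _; apply: subsetIl.
move=> x /bigcupP[B hB /setIP[Lx Cx]]; have [Y [sY0 sYc sYH]] := annY B hB.
apply: (word_vanish Ht sYH (k := 0%N)) => // [l z|].
  by rewrite add0n size_t => /(subsetP sYc)/set1P-> _; apply: dual1.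
by rewrite (subsetP sY0) // inE Cx (subsetP sLD).
Qed.

(** A positive level is generated by commutators [[~ z, x]] with [x] in [D], where the value of [u]
    is that of [Tend 1 x] applied to [u], one level lower. Descending to level 0 takes [k]
    letters. *)
Lemma words_separate (k : 'I_N.+1) (u : W) :
    (forall t : seq gT, {subset t <= D} -> size t = k -> forall y,
       vsval (ev (\prod_(x <- t) Tend 1 x) u) (ord0, y) = 0) ->
  forall y, vsval u (k, y) = 0.
Proof.
case: k => k lt_k; elim: k lt_k u => [|k IH] lt_k u uT y.
  have := uT [::]; rewrite big_nil ev1 => /(_ _ erefl y) <- //.
  by congr (vsval u (_, _)); apply: val_inj.
have [Ly | Ly] := boolP (y \in 'L_k.+2(D)%g); last exact: dual_out.
have lt_k' : (k < N.+1)%N by apply: ltnW.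
apply: (dual_gen0 (i := Ordinal lt_k)) Ly => // _ /imset2P[z x Lz Dx ->].
rewrite -(@ev_T_val 1 x u (Ordinal lt_k')) ?addn1 //.
apply: IH => t sDt size_t z'; have := uT (x :: t); rewrite big_cons evM; apply.
  by move=> x'; rewrite inE => /predU1P[-> | /sDt].
by rewrite /= size_t.
Qed.

End DualSpace.

(** A maximal normal subgroup of [H / K] has prime index [q], and the cyclic group of order [q]
    embeds in the additive group of any field of characteristic [q]. The prime comes first because
    the field is chosen to suit it. *)
Lemma exists_additive_character (gT : finGroupType) (H K : {group gT}) :
    solvable H -> (K <| H)%g -> ~~ (H \subset K)%g ->
  exists2 q, prime q /\ (q %| #|H|)%N &
    forall F : fieldType, q \in [pchar F] -> exists f : gT -> F,
      [/\ forall y z, y \in H -> z \in H -> f (y * z)%g = f y + f z,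
          forall y, y \in K -> f y = 0 & exists2 y, y \in H & f y != 0].
Proof.
move=> solH nsKH nsHK; have [sKH nKH] := andP nsKH.
have ntQ: (H / K != 1)%g by rewrite -subG1 quotient_sub1.
have [M maxM] := ex_maxnormal_ntrivg ntQ.
have solQ : solvable (H / K)%g := quotient_sol K solH.
have q_pr := index_maxnormal_sol_prime solQ maxM.
have [/andP[/proper_sub sMQ nMQ] _] := maxgroupP maxM.
set q := #|_ : _|%g in q_pr; pose g y := coset M (coset K y).
have card_qM: #|(H / K / M)%g| = q by rewrite card_quotient.
have /cyclicP[x defQM] : cyclic (H / K / M)%g by rewrite prime_cyclic // card_qM.
have ord_x : #[x]%g = q by rewrite -card_qM defQM.
have dvd_q : (q %| #|H|)%N.
  by rewrite (dvdn_trans (dvdn_indexg _ _)) // dvdn_morphim.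
have gx y : y \in H -> g y \in <[x]>%g.
  by move=> Hy; rewrite -defQM; do 2!apply: mem_quotient.
have gM y z : y \in H -> z \in H -> g (y * z)%g = (g y * g z)%g.
  move=> Hy Hz; have [nKy nKz] := (subsetP nKH y Hy, subsetP nKH z Hz).
  have nM v : v \in H -> coset K v \in 'N(M)%g.
    by move=> Hv; rewrite (subsetP nMQ) // mem_quotient.
  by rewrite /g !morphM ?nM.
exists q => // F qF.
(* A discrete logarithm to the base [x]; the default 0 occurs only outside [<[x]>]. *)
pose lg z : nat := if [pick i : 'I_q | (x ^+ i == z)%g] is Some i then i else 0.
have lgK z : z \in <[x]>%g -> (x ^+ lg z)%g = z.
  case/cyclePmin=> i; rewrite ord_x /lg => lt_i Dz.
  case: pickP => [j /eqP // | /(_ (Ordinal lt_i))].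
  by rewrite Dz eqxx.
have natr_eq m n : (x ^+ m = x ^+ n)%g -> m%:R = n%:R :> F.
  move/eqP; rewrite eq_expg_mod_order ord_x => /eqP Emn.
  by rewrite -(GRing.natr_mod_pchar qF) Emn (GRing.natr_mod_pchar qF).
exists (fun y => (lg (g y))%:R); split=> [y z Hy Hz | y Ky |].
- by rewrite -natrD; apply: natr_eq; rewrite expgD !lgK ?gM ?groupM ?gx.
- rewrite -[RHS]/(0%:R); apply: natr_eq.
  have Hy := subsetP sKH y Ky; rewrite lgK ?gx // /g.
  by rewrite (coset_id Ky) morph1.
have /morphimP[w nMw /morphimP[y nKy Hy Dw] Dx] : x \in (H / K / M)%g by rewrite defQM cycle_id.
exists y => //; have -> : (lg (g y))%:R = 1%:R :> F.
  by apply: natr_eq; rewrite lgK ?gx // /g -Dw -Dx.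
exact: oner_neq0.
Qed.

(** By Euler [p] divides [q ^ totient p - 1], so the field with [q ^ totient p] elements has a unit
    of order [p]. *)
Lemma exists_prim_root_field (p q : nat) : prime p -> prime q -> p != q ->
  exists (F : finFieldType) (w : F),
    [/\ q \in [pchar F], p.-primitive_root w & p%:R != 0 :> F].
Proof.
move=> p_pr q_pr neq_pq.
have co_qp : coprime q p by rewrite prime_coprime // dvdn_prime2 // eq_sym.
have phi0 : (0 < totient p)%N by rewrite totient_gt0 prime_gt0.
have [F qF cardF] := pPrimePowerField q_pr phi0.
have p_dvd : (p %| #|[set: {unit F}]|)%N.
  rewrite card_finField_unit cardF -subn1 -eqn_mod_dvd ?expn_gt0 ?prime_gt0 //.
  exact/eqP/Euler_exp_totient.
have [x _ ord_x] := Cauchy p_pr p_dvd.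
exists F, (FinRing.uval x); split=> //; last first.
  by rewrite -(dvdn_pcharf qF) dvdn_prime2 // eq_sym.
have vX : FinRing.uval x ^+ p = 1.
  by rewrite -FinRing.val_unitX -ord_x expg_order.
have [m prim_m m_dvd] := prim_order_exists (prime_gt0 p_pr) vX.
have /orP[/eqP m1 | /eqP <- //] := (primeP p_pr).2 m m_dvd.
have := prim_expr_order prim_m; rewrite m1 expr1 => vx1.
have x1 : x = 1%g by apply: val_inj.
by move: p_pr; rewrite -ord_x x1 order1.
Qed.

End LieRepresentations.

(** * The bound *)

Lemma der_sub_lcn (gT : finGroupType) (G : {group gT}) n : G^`(n) \subset 'L_n.+1(G).
Proof.
elim: n => [|n IHn] //; rewrite dergSn lcnSn; apply: (commgSS IHn).
exact: subset_trans IHn (lcn_sub _ _).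
Qed.

Lemma derD (gT : finGroupType) (G : {group gT}) m n : G^`(m + n) = G^`(m)^`(n).
Proof. by elim: n => [|n IH]; [rewrite addn0 | rewrite addnS !dergSn IH]. Qed.

Lemma lcn_proper (gT : finGroupType) (G : {group gT}) n :
  nilpotent G -> 'L_n.+1(G) != 1 -> ~~ ('L_n.+1(G) \subset 'L_n.+2(G)).
Proof.
move=> /forallP nilG ntL; apply: contra ntL => sLL.
have /implyP := nilG 'L_n.+1(G)%G; apply.
by rewrite subsetI lcn_sub /= -lcnSn.
Qed.

(** The second argument bounds the pairs of a special subgroup and a label, with [#|A| = p ^ k];
    [c.+1] is the length of the chain in [special_ann]; [d + c] bounds the derived length of the
    centralisers. *)
Definition class_bound (c p k d : nat) : nat :=
  family_bound p.-1 (special_bound (2 ^ (p ^ k)) d * p ^ (p ^ k))%N c.+1 (d + c).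

(** * The class bound for an action by conjugation *)

Section Internal.

Variables (gT : finGroupType) (c p k d : nat) (A G : {group gT}).
Hypotheses (p_pr : prime p) (abelA : p.-abelem A) (cardA : #|A| = (p ^ k)%N).
Hypotheses (nGA : A \subset 'N(G)) (p'G : p^'.-group G) (le_dk : (2 ^ d + 2 <= k)%N).
Hypothesis clC : forall a, a \in A^# -> nilpotent_class_le 'C_G[a]^`(d) c.

Let coGA : coprime #|G| #|A|.
Proof. by rewrite coprime_sym (pnat_coprime (abelem_pgroup abelA)). Qed.

Let nilC a : a \in A^# -> nilpotent 'C_G[a]^`(d).
Proof. by case/clC. Qed.

Let lcn_C a : a \in A^# -> 'L_c.+1('C_G[a]^`(d)) = 1.
Proof. by case/clC=> nilCa; move/(lcn_nil_classP _ nilCa). Qed.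

Lemma special_sub_der H : H \in Aspecial p A G d -> H \subset G^`(d).
Proof.
move=> sH; have [B [_ _ sHB]] := special_der sH.
by apply: subset_trans sHB (dergS _ _); apply: subsetIl.
Qed.

(** Choose [a] in [B] with [H] inside the [d]th derived group of ['C_G[a]]. Elements centralised by
    [B] normalise that group, so one commutator leads into it, and [c] more exhaust its lower
    central series. *)
Lemma special_ann H B : H \in Aspecial p A G d -> hyperplane p A B ->
  exists Y : nat -> {set gT},
    [/\ 'C_(G^`(d))(B) \subset Y 0, Y c.+1 \subset [set 1] &
        forall l, [~: Y l, H] \subset Y l.+1].
Proof.
move=> sH hB; have [a [Aa Ba sHa]] := special_der_cent1 p_pr cardA le_dk sH hB.
exists (fun l => if l is l'.+1 then 'L_l'.+1('C_G[a]^`(d)) else 'C_(G^`(d))(B)).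
split=> [//| |[|l]]; first by rewrite lcn_C.
  have sC: 'C_(G^`(d))(B) \subset 'C_G[a].
    by rewrite setISS ?der_sub // -cent_set1 centS ?sub1set.
  apply: subset_trans (commgSS sC sHa) _.
  by rewrite lcn1 commg_subr; apply: gFnorm.
by rewrite lcnSn commgS.
Qed.

Lemma nil_class_der : (nil_class G^`(d) <= class_bound c p k d)%N.
Proof.
set N := class_bound c p k d; pose D := (G^`(d))%G.
have nilD : nilpotent D := nilpotent_der p_pr abelA cardA nGA coGA le_dk nilC.
apply/(lcn_nil_classP N nilD)/eqP; apply/idPn=> ntL.
have sDG: D \subset G := der_sub d G.
have nDA: A \subset 'N(D) := char_norm_trans (der_char d G) nGA.
have coDA: coprime #|D| #|A| := coprimeSg sDG coGA.
have nsL: 'L_N.+2(D) <| 'L_N.+1(D) by rewrite (normalS (lcn_subS _ _) (lcn_sub _ _)) // lcn_normal.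
have solL: solvable 'L_N.+1(D) := solvableS (lcn_sub _ _) (nilpotent_sol nilD).
have [q [q_pr q_dvd] getf] := exists_additive_character solL nsL (lcn_proper nilD ntL).
have neq_pq : p != q.
  apply: contraTneq q_dvd => <-; rewrite -p'natE //.
  by apply: pgroupS p'G; apply: subset_trans (lcn_sub _ _) sDG.
have [F [w [qF prim_w pF]]] := exists_prim_root_field p_pr q_pr neq_pq.
have [f [fM f0 [y0 Ly0 fy0]]] := getf F qF.
(* The character [f] placed at the top level [N] gives a nonzero element of the dual. *)
pose phi := [ffun iy : 'I_N.+1 * gT =>
  if (iy.1 == ord_max) && (iy.2 \in 'L_N.+1(D)) then f iy.2 else 0%R].
have dphi : phi \in dual F D N.
  rewrite mem_dual; apply/dualbP; split=> [i y z Ly Lz | i y Ly | i y Ly]; rewrite !ffunE /=.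
  - have [i_max | _] := eqVneq i ord_max; last by rewrite GRing.addr0.
    by rewrite i_max /= in Ly Lz; rewrite groupM //= Ly Lz fM.
  - have [i_max | //] := eqVneq i ord_max; rewrite i_max /= in Ly.
    by rewrite f0 //; case: ifP.
  - have [i_max | //] := eqVneq i ord_max; rewrite i_max /= in Ly.
    by rewrite (negPf Ly).
have phi_neq0 : phi (ord_max, y0) != 0%R by rewrite ffunE /= eqxx Ly0.
have dim_dual : (0 < dim (subvs_of (dual F D N)))%N.
  rewrite -[dim _]/(\dim (dual F D N)) lt0n dimv_eq0; apply: contraNneq phi_neq0 => dual_eq0.
  have /eqP -> : (phi : {ffun 'I_N.+1 * gT -> F^o}) == 0%R by rewrite -memv0 -dual_eq0.
  by rewrite ffunE.
case/negP: phi_neq0; apply/eqP.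
have -> : phi = vsval (vsproj (dual F D N) phi) by rewrite vsprojK.
(* Words of [N] letters of degree 1 vanish by [graded_rep_nil], so [phi] would be 0 at level [N]. *)
apply: (words_separate (dual_proper := dim_dual)) => t sDt size_t y.
suff -> : (\prod_(x <- t) Tend dim_dual 1 x = 0)%R.
  by rewrite ev0 GRing.linear0 ffunE.
have nDa a : a \in A -> a \in 'N(D) by apply/subsetP.
have [B hB] : exists B, hyperplane p A B.
  by exists A; rewrite /hyperplane subxx leq_pmull ?prime_gt0.
have [a0 [Aa0 nta0]] : exists a0, a0 \in A /\ a0 != 1.
  have: A :!=: 1.
    rewrite -cardG_gt1 cardA -(expn0 p) ltn_exp2l ?prime_gt1 //.
    by rewrite (leq_trans _ le_dk) // addn2.
  by case/trivgPn=> a0; exists a0.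
have sol_a0 : 'C_D(<[a0]>)^`(d + c) = 1.
  have sC: 'C_D(<[a0]>) \subset 'C_G[a0] by rewrite cent_cycle setSI.
  have := subset_trans (dergS c (dergS d sC)) (der_sub_lcn _ c).
  rewrite lcn_C ?inE ?nta0 // => s1; apply/trivgP; apply: subset_trans s1.
  by rewrite -derD.
have Dp : p.-1.+1 = p := prednK (prime_gt0 p_pr).
apply: (@graded_rep_nil F _ gT D A p.-1 (Tend dim_dual) (@conjend _ _ _ _ dim_dual) w
  _ _ nDA coDA (nilpotent_sol nilD) _ _ _ _ _ _ _ _ _ _ _ (Aspecial p A G d)
  (special_bound (2 ^ (p ^ k)) d) c.+1 (d + c) a0); rewrite ?Dp //.
- exact: Tend_M.
- exact: Tend_0.
- exact: Tend_lie.
- exact: conjend_B.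
- exact: conjend_Z.
- by move=> a u v /nDa; apply: conjend_M.
- exact: conjend_1.
- by move=> a b u /nDa na /nDa; apply: conjend_G.
- by move=> a j x /nDa; apply: conjend_T.
- by rewrite -cardA size_special.
- move=> H sH; split; first exact: special_sub_der.
  by case: (special_norm abelA nGA sH).
- by move=> H K B'; apply: special_comm.
- exact: der_special.
- move=> H s sH Hs size_s; apply: (word_nil p_pr abelA nDA coDA) Hs size_s => B' hB'.
  exact: special_ann.
by rewrite size_t /= cardA.
Qed.

End Internal.

Theorem theorem3p1 :
  exists f : nat -> nat -> nat -> nat,
  forall (c p k : nat) (aT gT : finGroupType) (A : {group aT}) (G : {group gT})
         (to : groupAction A G),
    (0 < c)%N -> prime p -> (3 <= k)%N ->
    p.-abelem A -> #|A| = (p ^ k)%N -> p^'.-group G ->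
    forall d : nat, (2 ^ d + 2 <= k)%N ->
    (forall a : aT, a \in A^# -> nilpotent_class_le 'C_(G | to)[a]^`(d) c) ->
    nilpotent_class_le G^`(d) (f c k p).
Proof.
(* The bound may not depend on [d]; as [2 ^ d + 2 <= k] forces [d < k], a maximum over such [d]
   serves. *)
exists (fun c k p => \max_(d < k) class_bound c p k d).
move=> c p k aT gT A G to _ p_pr _ abelA cardA p'G d le_dk clC.
have lt_dk : (d < k)%N.
  by apply: leq_trans (ltn_expl d (ltnSn 1)) _; apply: leq_trans le_dk; apply: leq_addr.
(* The action is turned into conjugation inside the semidirect product, and hypotheses and
   conclusion are carried along the two injections. *)
have [inj1 inj2] := (injm_sdpair1 to, injm_sdpair2 to).
set f1 := sdpair1 to in inj1; set f2 := sdpair2 to in inj2.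
have abelA' : p.-abelem (f2 @* A) by rewrite injm_abelem.
have cardA' : #|f2 @* A| = (p ^ k)%N by rewrite card_injm.
have nGA' : f2 @* A \subset 'N(f1 @* G) := im_sdpair_norm to.
have p'G' : p^'.-group (f1 @* G) by rewrite morphim_pgroup.
have clC' a' : a' \in (f2 @* A)^# -> nilpotent_class_le 'C_(f1 @* G)[a']^`(d) c.
  case/setD1P=> nta' /morphimP[a _ Aa Da'].
  have nta: a != 1 by apply: contraNneq nta' => a1; rewrite Da' a1 morph1.
  have [|nilCa clCa] := clC a; first by rewrite !inE nta.
  have sCG: 'C_(G | to)[a] \subset G := subsetIl _ _.
  have -> : 'C_(f1 @* G)[a'] = f1 @* 'C_(G | to)[a].
    rewrite (gacentEsd to) morphim_setIpre morphim_set1 // -cent_set1 Da'.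
    by [].
  rewrite -morphim_der //; split.
    by rewrite injm_nil // (subset_trans (der_sub _ _)).
  by rewrite nil_class_injm // (subset_trans (der_sub _ _)).
have nilG' : nilpotent (f1 @* G)^`(d).
  apply: (nilpotent_der p_pr abelA' cardA' nGA' _ le_dk) => [|a /clC' [] //].
  by rewrite coprime_sym (pnat_coprime (abelem_pgroup abelA')).
have := nil_class_der p_pr abelA' cardA' nGA' p'G' le_dk clC'.
rewrite -morphim_der // in nilG' *; rewrite nil_class_injm ?der_sub // => le_cl.
split; first by rewrite injm_nil ?der_sub in nilG'.
by apply: leq_trans le_cl _; apply: (leq_bigmax (Ordinal lt_dk)).
Qed.
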